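(* Let $\{W_t\}_{t\ge1}$ be a stochastic process on a standard Borel alphabet $\mathcal W$, with full-future predictive states $\Sigma_t=P_{W_{t+1:\infty}\mid H_t}(\cdot\mid H_t)$. Then for every $t$: 1. (Full-future sufficiency and minimality.) $W_{t+1:\infty}\perp\!\!\!\perp H_t\mid\Sigma_t$. Moreover, if $T_t=\rho_t(H_t)$ is any history statistic satisfying $W_{t+1:\infty}\perp\!\!\!\perp H_t\mid T_t$, then there exists a measurable map $g_t$ such that $\Sigma_t=g_t(T_t)$ almost surely; equivalently, $\sigma(\Sigma_t)\subseteq\sigma(T_t)$ modulo $P$-null sets. 2. (Recursive update.) $\Sigma_{t+1}=\Phi(\Sigma_t,W_{t+1})$ almost surely. 3. (Markov representation.) The process $\{\Sigma_t\}$ is a Markov process admitting the transition kernel $$K(\sigma,B)\triangleq\int_{\mathcal W}\mathbf 1\{\Phi(\sigma,w)\in B\}\,\sigma_1(dw),\qquad B\in\mathcal B(\mathcal P(\mathcal W^{\mathbb N})).$$ Consequently, $\{\Sigma_t\}$ is itself a recursive predictive representation and is a measurable factor of every other full-future sufficient representation (i.e. $\Sigma_t=g_t(T_t)$ almost surely for measurable $g_t$), in particular of every recursive predictive representation.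
   Context: $H_t=W_{1:t}=(W_1,\dots,W_t)$ is the history at time $t$, with $H_0$ the empty history. $W_{t+1:\infty}=(W_{t+1},W_{t+2},\dots)$ is the future tail. The full-future predictive state is $\Sigma_t\triangleq P_{W_{t+1:\infty}\mid H_t}(\cdot\mid H_t)\in\mathcal P(\mathcal W^{\mathbb N})$, the regular conditional law of the tail given the history. Spaces $\mathcal P(\mathcal E)$ of probability measures carry the evaluation $\sigma$-field; fixed versions of conditional laws are used. For $\sigma\in\mathcal P(\mathcal W^{\mathbb N})$, $\sigma_1$ is its first-coordinate marginal. $\Phi:\mathcal P(\mathcal W^{\mathbb N})\times\mathcal W\to\mathcal P(\mathcal W^{\mathbb N})$ is a fixed jointly measurable kernel (it exists by measurable disintegration on standard Borel spaces) such that, for each $\sigma$, $\Phi(\sigma,w)$ is the conditional law of the coordinates $2,3,\dots$ under $\sigma$ given that the first coordinate equals $w$, with arbitrary values on $\sigma_1$-null observations. A history statistic $T_t=\rho_t(H_t)$ (measurable $\rho_t$, values in a standard Borel space $\mathcal T_t$) is *full-future sufficient* if $W_{t+1:\infty}\perp\!\!\!\perp H_t\mid T_t$. A state process $T_t=\rho_t(H_t)$ is a *recursive predictive representation* if for every $t$ it is full-future sufficient and recursively closed: there is a measurable map $\Psi_t:\mathcal T_t\times\mathcal W\to\mathcal T_{t+1}$ with $T_{t+1}=\Psi_t(T_t,W_{t+1})$ almost surely. *)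

(* Defs.v *)
From HB Require Import structures.
From mathcomp Require Import all_boot all_order all_algebra.
From mathcomp Require Import all_classical all_reals all_analysis.
From mathcomp Require Import measurable_realfun.

Set Implicit Arguments.
Unset Strict Implicit.
Unset Printing Implicit Defensive.

Import Order.TTheory GRing.Theory Num.Theory.
Import numFieldNormedType.Exports.

Local Open Scope classical_set_scope.
Local Open Scope ring_scope.
Local Open Scope ereal_scope.

Definition polish (R : realType) (M : metricType R) : Prop :=
  (forall F : set_system M, ProperFilter F -> cauchy F ->
     exists x : M, F --> x) /\
  (exists2 S : set M, countable S & dense S).

(* T is isomorphic, as a measurable space, to a Borel subset Y of a Polish
   space; as Y is Borel, its trace sigma-algebra consists of the Borel sets of
   M contained in Y. *)
Definition standard_borel (R : realType) d (T : measurableType d) : Prop :=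
  exists (M : metricType R) (Y : set M) (f : T -> M),
    [/\ polish M, <<s open >> Y, set_bij [set: T] Y f &
        forall A : set T, measurable A <-> <<s open >> (f @` A)].

Section law.
Local Open Scope ereal_scope.
Context d (T : measurableType d) (R : realType).

(* A probability of the library is a function on all subsets of T, whose values
   on non-measurable sets are unconstrained: two of them that agree on
   measurable sets need not be equal. The type law normalizes these values to 0,
   so that equality of laws is equality of probability measures. *)
Record law := Law {
  law_prob :> probability T R ;
  law_nonmeasurable : forall B : set T, ~ measurable B -> law_prob B = 0 }.

Lemma law_eqP (mu nu : law) :
  (forall B : set T, measurable B -> mu B = nu B) -> mu = nu.
Proof.
case: mu nu => [mu mu0] [nu nu0] /= munu.
have E : mu = nu :> (set T -> \bar R).
  apply/funext => B.
  by have [mB|mB] := pselect (measurable B); [exact: munu|rewrite mu0// nu0].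
have {}E : mu = nu.
  case: mu nu E {munu mu0 nu0} => [f Hf] [g Hg] /= fg.
  subst g; congr Probability.Pack.
  case: Hf Hg => [[f1 f2] [f3] [f4] [f5] [f6] [f7] [f8]].
  case=> [[g1 g2] [g3] [g4] [g5] [g6] [g7] [g8]].
  rewrite (_ : g1 = f1) 1?(_ : g2 = f2) 1?(_ : g3 = f3); do ?exact: Prop_irrelevance.
  by f_equal; f_equal; exact: Prop_irrelevance.
by subst nu; congr Law; exact: Prop_irrelevance.
Qed.

Section normalization.
Variable mu : probability T R.

Definition normalize_nonmeasurable (B : set T) : \bar R :=
  if `[< measurable B >] then mu B else 0.

Let nE B : measurable B -> normalize_nonmeasurable B = mu B.
Proof. by move=> mB; rewrite /normalize_nonmeasurable asboolT. Qed.

Let n0 : normalize_nonmeasurable set0 = 0.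
Proof. by rewrite nE// measure0. Qed.

Let n_ge0 B : 0 <= normalize_nonmeasurable B.
Proof. by rewrite /normalize_nonmeasurable; case: ifP. Qed.

Let n_sigma_additive : semi_sigma_additive normalize_nonmeasurable.
Proof.
move=> F mF tF mUF; rewrite nE//.
rewrite (_ : (fun n => _) = fun n => \sum_(0 <= i < n) mu (F i)).
  exact: measure_semi_sigma_additive.
by apply/funext => n; apply: eq_bigr => i _; rewrite nE.
Qed.

HB.instance Definition _ := isMeasure.Build _ _ _ normalize_nonmeasurable
  n0 n_ge0 n_sigma_additive.

Let n_setT : normalize_nonmeasurable setT = 1.
Proof. by rewrite nE// probability_setT. Qed.

HB.instance Definition _ :=
  Measure_isProbability.Build _ _ _ normalize_nonmeasurable n_setT.

Let n_nonmeasurable (B : set T) : ~ measurable B ->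
  normalize_nonmeasurable B = 0.
Proof. by move=> mB; rewrite /normalize_nonmeasurable asboolF. Qed.

Definition law_of : law := @Law normalize_nonmeasurable n_nonmeasurable.

Lemma law_ofE B : measurable B -> law_of B = mu B.
Proof. exact: nE. Qed.

End normalization.

HB.instance Definition _ := gen_eqMixin law.
HB.instance Definition _ := gen_choiceMixin law.
HB.instance Definition _ := isPointed.Build law (law_of point).

(* the evaluation sigma-algebra, generated by the maps mu |-> mu B *)
Definition evaluation_sets : set_system law :=
  \bigcup_(B in [set B : set T | measurable B])
    preimage_set_system setT (fun mu : law => mu B) measurable.

HB.instance Definition _ :=
  @isMeasurable.Build (sigma_display evaluation_sets) law <<s evaluation_sets >>
    (@sigma_algebra0 _ setT evaluation_sets)
    (@sigma_algebraC _ evaluation_sets)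
    (@sigma_algebra_bigcup _ setT evaluation_sets).

End law.

Section path_space.
Context d (W : measurableType d).

Definition cylinder : set_system (nat -> W) :=
  \bigcup_n preimage_set_system setT (fun x : nat -> W => x n) measurable.

(* W^N with the product sigma-algebra *)
Definition paths : measurableType cylinder.-sigma :=
  g_sigma_algebraType cylinder.

Definition path_head (x : paths) : W := x 0%N.

Definition path_tail (x : paths) : paths := fun n => x n.+1.

End path_space.

Section conditioning.
Context d (Omega : measurableType d) (R : realType) (P : probability Omega R).

(* f is a version of the conditional probability of E given the
   sub-sigma-algebra G *)
Definition cond_prob (G : set_system Omega) (E : set Omega)
    (f : Omega -> \bar R) : Prop :=
  [/\ forall B : set (\bar R), measurable B -> G (f @^-1` B),
      P.-integrable [set: Omega] f &
      forall A, G A -> \int[P]_(w in A) f w = P (A `&` E)].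

(* k is a version of the regular conditional law of Y given X *)
Definition regular_cond_law d1 (E : measurableType d1)
    d2 (F : measurableType d2) (Y : Omega -> F) (X : Omega -> E)
    (k : E -> law F R) : Prop :=
  measurable_fun [set: E] k /\
  forall B, measurable B ->
    cond_prob (g_sigma_algebra_preimage X) (Y @^-1` B)
      (fun w => k (X w) B).

(* Y and X are conditionally independent given Z:
   P(Y in B, X in A | Z) = P(Y in B | Z) P(X in A | Z) almost surely.
   Two versions of a conditional probability agree almost surely, so the choice
   of f and g is immaterial. *)
Definition cond_indep d1 (E1 : measurableType d1) d2 (E2 : measurableType d2)
    d3 (E3 : measurableType d3)
    (Y : Omega -> E1) (X : Omega -> E2) (Z : Omega -> E3) : Prop :=
  forall (B : set E1) (A : set E2), measurable B -> measurable A ->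
    exists f g : Omega -> \bar R,
      [/\ cond_prob (g_sigma_algebra_preimage Z) (Y @^-1` B) f,
          cond_prob (g_sigma_algebra_preimage Z) (X @^-1` A) g &
          cond_prob (g_sigma_algebra_preimage Z) (Y @^-1` B `&` X @^-1` A)
            (fun w => f w * g w)].

Definition sub_mod_null (G1 G2 : set_system Omega) : Prop :=
  forall A, G1 A -> exists2 B, G2 B & P (A `+` B) = 0.

Definition natural_filtration d1 (E : measurableType d1) (S : nat -> Omega -> E)
    (t : nat) : set_system Omega :=
  <<s \bigcup_(s in [set s | (s <= t)%N]) g_sigma_algebra_preimage (S s) >>.

Definition markov_process d1 (E : measurableType d1) (S : nat -> Omega -> E)
    (k : R.-pker E ~> E) : Prop :=
  (forall t, measurable_fun [set: Omega] (S t)) /\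
  forall t B, measurable B ->
    cond_prob (natural_filtration S t) (S t.+1 @^-1` B) (fun w => k (S t w) B).

End conditioning.

(* The process is indexed from 0: X n stands for W_{n+1}. *)
Section process.
Context d (Omega : measurableType d) (R : realType) (P : probability Omega R).
Context dW (W : measurableType dW) (X : nat -> Omega -> W).

(* H_t = (W_1, ..., W_t) *)
Definition history (t : nat) (w : Omega) : t.-tuple W := [tuple X i w | i < t].

(* W_{t+1:oo} = (W_{t+1}, W_{t+2}, ...) *)
Definition future (t : nat) (w : Omega) : paths W := fun n => X (t + n)%N w.

Section statistic.
Context (t : nat) dT (T : measurableType dT) (rho : t.-tuple W -> T).

Definition history_statistic : Prop :=
  standard_borel R T /\ measurable_fun [set: t.-tuple W] rho.

Definition full_future_sufficient : Prop :=
  history_statistic /\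
  cond_indep P (future t) (history t) (rho \o history t).

End statistic.

Section state_process.
Context (dT : nat -> measure_display) (T : forall t, measurableType (dT t)).
Variable rho : forall t, t.-tuple W -> T t.

Definition recursively_closed : Prop :=
  forall t, exists Psi : T t * W -> T t.+1,
    measurable_fun [set: T t * W] Psi /\
    {ae P, forall w, rho (history t.+1 w) = Psi (rho (history t w), X t w)}.

Definition recursive_predictive_representation : Prop :=
  (forall t, full_future_sufficient (@rho t)) /\ recursively_closed.

End state_process.
End process.

Section update.
Context (R : realType) dW (W : measurableType dW).

(* Phi(s, w) is the conditional law of the coordinates 2, 3, ... under s given
   that the first coordinate equals w *)
Definition tail_disintegration
    (Phi : law (paths W) R * W -> law (paths W) R) : Prop :=
  measurable_fun [set: law (paths W) R * W] Phi /\
  forall s : law (paths W) R,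
    regular_cond_law s
      (@path_tail _ W) (@path_head _ W) (fun w => Phi (s, w)).

Definition first_marginal (s : law (paths W) R) : set W -> \bar R :=
  pushforward s (@path_head _ W).

Definition update_kernel
    (Phi : law (paths W) R * W -> law (paths W) R)
    (s : law (paths W) R) (B : set (law (paths W) R)) : \bar R :=
  \int[first_marginal s]_w (\1_B (Phi (s, w)))%:E.

End update.

(* Main.v *)
(* The conditional law of the future given H_t is a function Sigma_t of H_t, so
   conditioning on Sigma_t or on H_t gives the same probabilities to future
   events: this is sufficiency. If T is sufficient then the conditional
   probability of a future event given T is one given H_t, hence Sigma_t(B) is
   almost surely a function of T for each of countably many B that determine the
   law. Disintegrating P along H_t, and then the law Sigma_t along its first
   coordinate, shows that Phi(Sigma_t, W_{t+1}) is a conditional law of the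
   future given H_{t+1}; integrating the indicator of Phi(Sigma_t, .) in B
   against Sigma_t gives the transition kernel.

   That laws on the path space form a standard Borel space, and are determined
   by countably many events, is obtained from explicit measurable retractions:
   a Polish space embeds in R^N by the distances to a dense sequence, R^N in R by
   Dedekind cuts and ternary expansions, and laws on R in R^N by the values of
   the distribution function at the rationals, with the quantile function
   giving the way back. *)
Require Import Defs.
From HB Require Import structures.
From mathcomp Require Import all_boot all_order all_algebra.
From mathcomp Require Import all_classical all_reals all_analysis.
From mathcomp Require Import measurable_realfun.
From mathcomp Require Import ring lra giry.

Set Implicit Arguments.
Unset Strict Implicit.
Unset Printing Implicit Defensive.

Import Order.TTheory GRing.Theory Num.Theory.
Import numFieldNormedType.Exports.

Local Open Scope classical_set_scope.
Local Open Scope ring_scope.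
Local Open Scope ereal_scope.

(** * Measurable retracts *)

(* A measurable retract of a standard Borel space is standard Borel: the image
   of e is the set of the y such that e (r y) = y. *)
Definition measurable_retract d1 (T : measurableType d1)
    d2 (U : measurableType d2) : Prop :=
  exists (e : T -> U) (r : U -> T),
    [/\ measurable_fun [set: T] e, measurable_fun [set: U] r & cancel e r].

Lemma measurable_retract_trans d1 (T : measurableType d1)
    d2 (U : measurableType d2) d3 (V : measurableType d3) :
  measurable_retract T U -> measurable_retract U V -> measurable_retract T V.
Proof.
move=> [e [r [me mr er]]] [e' [r' [me' mr' er']]].
exists (e' \o e), (r \o r'); split; [| |exact: can_comp].
- exact: measurableT_comp.
- exact: measurableT_comp.
Qed.

Lemma measurable_fun_coord d (W : measurableType d) n :
  measurable_fun [set: paths W] (fun x : paths W => x n).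
Proof.
by move=> _ B mB; apply: sub_sigma_algebra; exists n => //; exists B.
Qed.

Lemma measurable_fun_paths d (T : measurableType d) dW (W : measurableType dW)
    (f : T -> paths W) :
  (forall n, measurable_fun [set: T] (fun x => f x n)) ->
  measurable_fun [set: T] f.
Proof.
move=> mf; apply: (@measurability _ _ T (paths W) setT f (@cylinder _ W)) => //.
by move=> _ [_ [n _ [B mB <-]] <-]; rewrite !setTI; rewrite -[X in measurable
  X]setTI; exact: mf.
Qed.

Lemma measurable_path_head d (W : measurableType d) :
  measurable_fun [set: paths W] (@path_head _ W).
Proof. exact: measurable_fun_coord. Qed.

Lemma measurable_path_tail d (W : measurableType d) :
  measurable_fun [set: paths W] (@path_tail _ W).
Proof. by apply: measurable_fun_paths => n; exact: measurable_fun_coord. Qed.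

Lemma measurable_retract_paths d1 (T : measurableType d1)
    d2 (U : measurableType d2) :
  measurable_retract T U -> measurable_retract (paths T) (paths U).
Proof.
move=> [e [r [me mr er]]].
exists (fun x n => e (x n)), (fun x n => r (x n)); split.
- apply: measurable_fun_paths => n.
  exact: (measurableT_comp me (@measurable_fun_coord _ T n)).
- apply: measurable_fun_paths => n.
  exact: (measurableT_comp mr (@measurable_fun_coord _ U n)).
- by move=> x; apply/funext => n; rewrite er.
Qed.

(** A double sequence is listed along the pairing [pickle]; the default pair [(0, 0)] only fills
    positions that the decoder never reads. *)
Lemma measurable_retract_paths2 d (W : measurableType d) :
  measurable_retract (paths (paths W)) (paths W).
Proof.
pose dec n : nat * nat := odflt (0, 0)%N (unpickle n).
exists (fun x n => x (dec n).1 (dec n).2), (fun y i j => y (pickle (i, j)));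
  split.
- apply: measurable_fun_paths => n.
  exact: (measurableT_comp (@measurable_fun_coord _ W (dec n).2)
    (@measurable_fun_coord _ (paths W) (dec n).1)).
- apply: (@measurable_fun_paths _ _ _ (paths W)) => i.
  by apply: measurable_fun_paths => j; exact: measurable_fun_coord.
- by move=> x; apply/funext => i; apply/funext => j; rewrite /dec pickleK.
Qed.

Definition rational_seq (n : nat) : rat := odflt 0%R (unpickle n).

Lemma rational_seqP (q : rat) : exists n, rational_seq n = q.
Proof. by exists (pickle q); rewrite /rational_seq pickleK. Qed.

Lemma rational_seq_between (R : realType) (x y : R) : (x < y)%R ->
  exists n, (x < ratr (rational_seq n) < y)%R.
Proof.
move=> /rat_in_itvoo[q]; rewrite in_itv/= => xqy.
by have [n nq] := rational_seqP q; exists n; rewrite nq.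
Qed.

Lemma einfs0_lt (R : realType) (u : (\bar R)^nat) (x : \bar R) :
  einfs u 0%N < x <-> exists n, u n < x.
Proof.
split=> [/ereal_inf_lt[_ [n _ <-]] nx|[n nx]]; first by exists n.
by apply: le_lt_trans nx; apply: ereal_inf_lbound; exists n.
Qed.

Lemma measurable_fun_bool_set d (T : measurableType d) (f : T -> bool) :
  measurable [set x | f x] -> measurable_fun [set: T] f.
Proof.
move=> mf; apply: (@measurable_fun_bool _ _ _ _ true).
by rewrite setTI.
Qed.

(* A real number is coded by its upper Dedekind cut, and decoded by an infimum
   of rationals. *)
Lemma measurable_retract_real_cantor (R : realType) :
  measurable_retract R (paths bool).
Proof.
pose u (b : paths bool) n : \bar R :=
  if b n then (ratr (rational_seq n))%:E else +oo.
exists (fun x n => x < ratr (rational_seq n))%R, (fun b => fine (einfs (u b)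
  0%N)).
split.
- apply: measurable_fun_paths => n.
  exact: measurable_fun_ltr.
- apply: measurableT_comp => //.
  apply: (@measurable_fun_einfs _ _ _ _ (fun n b => u b n)) => n.
  apply: measurable_fun_ifT => //.
  exact: measurable_fun_coord.
- move=> x; set U := u _.
  suff -> : einfs U 0%N = x%:E by [].
  apply/eqP; rewrite eq_le; apply/andP; split.
  + apply/lee_addgt0Pr => e e0; rewrite -EFinD.
    have [n /andP[xn nx]] : exists n, (x < ratr (rational_seq n) < x + e)%R.
      by apply: rational_seq_between; rewrite ltrDl.
    by apply/ltW/einfs0_lt; exists n; rewrite /U /u xn lte_fin.
  + rewrite leNgt; apply/negP => /einfs0_lt[n]; rewrite /U /u.
    by case: ifP => // xn; rewrite lte_fin ltNge ltW.
Qed.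

(** * Bit sequences as real numbers *)

Section ternary.
Variable R : realType.

(* The Cantor function: with digits 0 and 2 in base 3 the digits can be read off
   the sum by iterating a piecewise affine map. *)
Definition ternary_term (b : paths bool) (n : nat) : R :=
  if b n then (2 / 3 ^+ n.+1)%R else 0%R.

Definition ternary (b : paths bool) : \bar R :=
  \sum_(n <oo) (ternary_term b n)%:E.

Lemma ternary_term_ge0 b n : (0 <= ternary_term b n)%R.
Proof. by rewrite /ternary_term; case: ifP. Qed.

Lemma ternary_ge0 b : 0 <= ternary b.
Proof. by apply: nneseries_ge0 => n _ _; rewrite lee_fin ternary_term_ge0. Qed.

Lemma ternary_le1 b : ternary b <= 1.
Proof.
apply: lime_le.
  by apply: is_cvg_nneseries => n _ _; rewrite lee_fin ternary_term_ge0.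
(* The bound 1 - 3^-N is the partial sum when all digits equal 2. *)
apply: nearW => N; apply: (@le_trans _ _ (1 - 3 ^- N)%:E); last first.
  by rewrite lee_fin lerBlDr lerDl.
rewrite sumEFin lee_fin; elim: N => [|N IH].
  by rewrite big_geq// expr0 invr1 subrr.
rewrite big_nat_recr//=; apply: (le_trans (lerD IH (lexx _))).
have : (ternary_term b N <= 2 / 3 ^+ N.+1)%R.
  by rewrite /ternary_term; case: ifP.
have : (0 < 3 ^+ N :> R)%R by rewrite exprn_gt0.
rewrite exprS; move: (3 ^+ N)%R => t t0 h.
apply: (le_trans (lerD (lexx _) h)).
by rewrite le_eqVlt; apply/orP; left; apply/eqP; field; lra.
Qed.

Lemma ternary_fin_num b : ternary b \is a fin_num.
Proof.
by rewrite ge0_fin_numE ?ternary_ge0// (le_lt_trans (ternary_le1 b))// ltry.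
Qed.

Lemma measurable_ternary : measurable_fun [set: paths bool] ternary.
Proof.
apply: (@ge0_emeasurable_sum _ _ _ _ (fun n b => (ternary_term b n)%:E)
  xpredT) => [n b _ _|n _].
  by rewrite lee_fin ternary_term_ge0.
apply/measurable_EFinP; apply: measurable_fun_ifT => //.
exact: measurable_fun_coord.
Qed.

Lemma ternary_rec b :
  fine (ternary b) = ((if b 0%N then 2 else 0) / 3 +
    fine (ternary (path_tail b)) / 3)%R.
Proof.
have t0 c n : 0 <= (ternary_term c n)%:E by rewrite lee_fin ternary_term_ge0.
have -> : ternary b = (ternary_term b 0%N)%:E + (3^-1)%:E * ternary (path_tail
  b).
  rewrite /ternary nneseries_recl//; congr (_ + _).
  rewrite -nneseries_addn// -nneseriesZl//; apply: eq_eseriesr => n _.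
  rewrite -EFinM addn1 /ternary_term /path_tail.
  case: ifP => _; rewrite ?mulr0//; congr EFin.
  by rewrite !exprS !invfM !mulrA [(_ * 2)%R]mulrC.
rewrite -(fineK (ternary_fin_num (path_tail b))) -EFinM -EFinD /=.
by congr (_ + _)%R; [rewrite /ternary_term expr1; case: ifP => //; rewrite
  mul0r|rewrite mulrC].
Qed.

Definition ternary_shift (x : R) : R :=
  if (2^-1 <= x)%R then (3 * x - 2)%R else (3 * x)%R.

(** The later digits contribute at most 1/3, so the sum lies in [0, 1/3] or in [2/3, 1] according to
    the first digit, and 1/2 separates the two. *)
Lemma ternary_digit b : (2^-1 <= fine (ternary b))%R = b 0%N.
Proof.
rewrite ternary_rec.
have := ternary_ge0 (path_tail b); have := ternary_le1 (path_tail b).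
rewrite -(fineK (ternary_fin_num (path_tail b))) !lee_fin => h1 h2.
case: (b 0%N); first by apply/idP; lra.
by apply/negbTE; rewrite -ltNge; lra.
Qed.

Lemma ternary_shiftE b :
  ternary_shift (fine (ternary b)) = fine (ternary (path_tail b)).
Proof.
by rewrite /ternary_shift ternary_digit ternary_rec; case: (b 0%N); field.
Qed.

Lemma measurable_retract_cantor_real : measurable_retract (paths bool) R.
Proof.
exists (fun b => fine (ternary b)),
  (fun x n => 2^-1 <= iter n ternary_shift x)%R; split.
- by apply: measurableT_comp => //; exact: measurable_ternary.
- apply: measurable_fun_paths => n.
  apply: measurable_fun_ler => //.
  elim: n => [|n IH] /=; first exact: measurable_id.
  apply: (measurableT_comp _ IH) => //.
  apply: measurable_fun_ifT.
  + exact: measurable_fun_ler.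
  + by apply: measurable_funB => //; apply: measurable_funM.
  + by apply: measurable_funM.
- move=> b; apply/funext => n.
  have -> : iter n ternary_shift (fine (ternary b)) =
      fine (ternary (iter n (@path_tail _ bool) b)).
    by elim: n => [//|n IH] /=; rewrite IH ternary_shiftE.
  rewrite ternary_digit.
  suff H k : iter n (@path_tail _ bool) b k = b (n + k)%N by rewrite H addn0.
  by elim: n k => [//|n IH] k; rewrite iterS /path_tail IH addnS.
Qed.

End ternary.

(** Each real becomes a bit sequence; the resulting double sequence of bits is flattened and read as
    one real. *)
Lemma measurable_retract_real_paths (R : realType) :
  measurable_retract (paths R) R.
Proof.
apply: measurable_retract_trans (@measurable_retract_cantor_real R).
apply: measurable_retract_trans (measurable_retract_paths2 bool).
by apply: measurable_retract_paths; exact: measurable_retract_real_cantor.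
Qed.

(** * Kuratowski embedding of a Polish space into real sequences *)

Section distance_embedding.
Variables (R : realType) (M : metricType R) (s : nat -> M).
Hypothesis s_dense : forall (x : M) (e : R), (0 < e)%R ->
  exists n, (mdist (s n) x < e)%R.

Definition distances (x : M) : paths R := fun n => mdist (s n) x.

Lemma distances_inj : injective distances.
Proof.
move=> x y xy; apply: mdist_positivity; apply/eqP.
rewrite eq_le mdist_ge0 andbT; apply/ler_addgt0Pl => e e0; rewrite addr0.
have [n nx] := s_dense x (divr_gt0 e0 (ltr0n _ 2)).
have ny : (mdist (s n) y < e / 2)%R by rewrite -[mdist _ _]/(distances y n) -xy.
rewrite (le_trans (metric_triangle _ (s n) _))// (splitr e) lerD//.
- by rewrite metric_sym ltW.
- exact: ltW.
Qed.

(** Only countably many conditions occur, each on finitely many coordinates, which is what makes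
    this set measurable. *)
Definition distance_functions : set (paths R) :=
  [set r | (forall i j, r i <= r j + mdist (s i) (s j))%R /\
    (forall i j, mdist (s i) (s j) <= r i + r j)%R /\
    (forall n, exists i, r i < n.+1%:R^-1)%R].

Hypothesis M_complete : forall F : set_system M, ProperFilter F -> cauchy F ->
  exists x : M, F --> x.

(* Kuratowski: a Katetov function with infimum 0 is the distance to the limit of
   a Cauchy sequence of points s (k n). *)
Lemma range_distances : range distances = distance_functions.
Proof.
apply/seteqP; split => [_ [x _ <-]|r [r_lip [r_tri r_inf]]].
  rewrite /distances; split=> [i j|]; last split=> [i j|n].
  - by rewrite addrC metric_triangle.
  - by rewrite [in X in (_ <= _ + X)%R]metric_sym metric_triangle.
  - exact: s_dense.
have [k rk] := choice r_inf.
(* By [r_tri], [s (k N)] and [s (k n)] are closer than 1/(N+1) + 1/(n+1), which is at most 2/(N+1)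
   for n >= N; [N] is chosen to make this less than [e]. *)
have s_cauchy : cauchy (s (k n) @[n --> \oo]).
  apply: cauchy_exP => e e0.
  pose N := Num.truncn (2 / e).
  have Ne : (2 / e < N.+1%:R)%R by exact: truncnS_gt.
  exists (s (k N)); exists N => // n /= Nn.
  rewrite ballEmdist /=; apply: (le_lt_trans (r_tri _ _)).
  apply: (@lt_trans _ _ (N.+1%:R^-1 + n.+1%:R^-1)%R).
    by rewrite ltrD.
  apply: (@le_lt_trans _ _ (2 / N.+1%:R)%R).
    by rewrite mulr_natl mulr2n lerD// lef_pV2 ?posrE// ler_nat.
  by rewrite ltr_pdivrMr// mulrC -ltr_pdivrMr.
have [x sx] := M_complete _ s_cauchy.
exists x => //; apply/funext => i; rewrite /distances.
have ball_s (e : R) : (0 < e)%R -> exists n, (r (k n) < e)%R /\ (mdist x (s (k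
  n)) < e)%R.
  move=> e0.
  have [N _ xN] : \forall n \near \oo, ball x e (s (k n)).
    by apply: sx; exact: nbhsx_ballx.
  pose N' := maxn N (Num.truncn (e^-1)).
  exists N'; split; last first.
    by have := xN N' (leq_maxl _ _); rewrite ballEmdist.
  apply: (lt_le_trans (rk _)).
  rewrite invf_ple ?posrE//; apply: ltW; apply: (lt_le_trans (truncnS_gt _)).
  by rewrite ler_nat ltnS leq_maxr.
apply/eqP; rewrite eq_le; apply/andP; split; apply/ler_addgt0Pr => e e0;
  have [n [rn xn]] := ball_s _ (divr_gt0 e0 (ltr0n _ 2)).
- apply: (le_trans (metric_triangle _ (s (k n)) _)).
  rewrite (splitr e) addrA lerD//; last by rewrite metric_sym ltW.
  by apply: (le_trans (r_tri _ _)); rewrite lerD2l ltW.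
- apply: (le_trans (r_lip i (k n))).
  rewrite (splitr e) addrCA lerD//; first exact: ltW.
  by rewrite (le_trans (metric_triangle _ x _))// lerD2l ltW.
Qed.

Lemma measurable_distance_functions : measurable distance_functions.
Proof.
rewrite /distance_functions.
have mc n := @measurable_fun_coord _ R n.
have mset (P : paths R -> bool) : measurable_fun [set: paths R] P ->
    measurable [set r | P r].
  by move=> mP; rewrite -[X in measurable X]setTI; exact: mP.
rewrite (_ : [set r | _] =
  (\bigcap_i \bigcap_j [set r : paths R | (r i <= r j + mdist (s i) (s j))%R])
    `&`
  ((\bigcap_i \bigcap_j [set r : paths R | (mdist (s i) (s j) <= r i + r j)%R])
    `&`
   (\bigcap_n \bigcup_i [set r : paths R | (r i < n.+1%:R^-1)%R]))); last first.
  apply/seteqP; split=> [r [h1 [h2 h3]]|r [h1 [h2 h3]]].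
    split; first by move=> i _ j _; exact: h1.
    split; first by move=> i _ j _; exact: h2.
    by move=> n _; have [i] := h3 n; exists i.
  split; first by move=> i j; exact: h1.
  split; first by move=> i j; exact: h2.
  by move=> n; have [i] := h3 n Logic.I; exists i.
apply: measurableI; first (apply: bigcapT_measurable => i; apply:
  bigcapT_measurable => j).
  apply: mset; apply: (@measurable_fun_ler _ _ R setT (fun r : paths R => r i)
    (fun r => r j + mdist (s i) (s j))%R) => //.
  exact: measurable_funD.
apply: measurableI; first (apply: bigcapT_measurable => i; apply:
  bigcapT_measurable => j).
  apply: mset; apply: (@measurable_fun_ler _ _ R setT (fun=> mdist (s i) (s j))
    (fun r : paths R => r i + r j)%R) => //.
  exact: measurable_funD.
apply: bigcapT_measurable => i; apply: bigcupT_measurable => j.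
by apply: mset; exact: measurable_fun_ltr.
Qed.

(** The sets with measurable image form a sigma-algebra: by injectivity a complement goes to the
    range minus the image, and the range is measurable. Open sets are then enough. *)
Lemma measurable_image_distances (A : set M) :
  <<s open >> A -> measurable (distances @` A).
Proof.
move: A; apply: smallest_sub; last first.
  move=> A oA.
  (* The balls of center s i and radius 1 / (j + 1) form a countable base. *)
  pose J i := [set j | [set x | (distances x i < j.+1%:R^-1)%R] `<=` A].
  rewrite (_ : distances @` A = range distances `&` \bigcup_i
    \bigcup_(j in J i) [set r : paths R | (r i < j.+1%:R^-1)%R]); last first.
    apply/seteqP; split=> [_ [x Ax <-]|_ [[x _ <-]] [i _ [j Jij xij]]]; last
      first.
      by exists x => //; exact: Jij.
    split; first by exists x.
    have /nbhs_ballP[e /= e0 xeA] : nbhs x A by exact: open_nbhs_nbhs.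
    pose j := Num.truncn (2 / e).
    have je : (j.+1%:R^-1 < e / 2)%R.
      by rewrite invf_plt ?posrE ?divr_gt0// invf_div truncnS_gt.
    have j0 : (0 < j.+1%:R^-1 :> R)%R by rewrite invr_gt0 ltr0Sn.
    have [i six] := s_dense x j0.
    exists i => //; exists j => //=.
    move=> y /= iy; apply: xeA; rewrite ballEmdist /=.
    apply: (le_lt_trans (metric_triangle _ (s i) _)).
    rewrite (splitr e) metric_sym ltrD//.
    - exact: lt_trans je.
    - exact: lt_trans je.
  apply: measurableI.
    by rewrite range_distances; exact: measurable_distance_functions.
  apply: bigcupT_measurable => i; apply: bigcup_measurable => j _.
  rewrite -[X in measurable X]setTI.
  by apply: measurable_fun_ltr => //; exact: measurable_fun_coord.
split.
- by rewrite /= image_set0.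
- move=> A; rewrite /= setTD => mA.
  rewrite (_ : distances @` (~` A) = range distances `\` distances @` A).
    apply: measurableD => //.
    by rewrite range_distances; exact: measurable_distance_functions.
  apply/seteqP; split=> [_ [x nAx <-]|_ [[x _ <-] nAx]].
    by split; [exists x|move=> [y Ay /distances_inj yx]; apply: nAx; rewrite
      -yx].
  by exists x => // Ax; apply: nAx; exists x.
- by move=> F mF; rewrite /= image_bigcup; exact: bigcupT_measurable.
Qed.

End distance_embedding.

Lemma borelI (T : topologicalType) (A B : set T) :
  <<s open >> A -> <<s open >> B -> <<s open >> (A `&` B).
Proof.
have : sigma_algebra setT <<s @open T >> by exact: smallest_sigma_algebra.
by move/sigma_algebraP => [//|_ _ _]; exact.
Qed.

(** The code is the isomorphism with [Y] followed by [distances s]. It maps measurable sets to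
    measurable sets, so its inverse, set to [point] off the range, is measurable. *)
Lemma standard_borel_retract (R : realType) d (T : measurableType d) :
  standard_borel R T -> measurable_retract T (paths R).
Proof.
move=> [M [Y [f [[M_complete [S cS dS]] YB [f_fun f_inj f_surj] f_meas]]]].
(* [M] contains [f point], so a dense set is inhabited; this excludes the empty case when [S] is
   enumerated. *)
have [s0 Ss0] : S !=set0.
  have [x [_ Sx]] := dS setT (ex_intro _ (f point) Logic.I) openT.
  by exists x.
have [s Ss] : exists s : nat -> M, S `<=` range s.
  move/pfcard_geP : cS => [S0|/unsquash s]; first by rewrite S0 in Ss0.
  by exists s => x /(@surj _ _ _ _ s)[n _ <-]; exists n.
have s_dense (x : M) (e : R) : (0 < e)%R -> exists n, (mdist (s n) x < e)%R.
  move=> e0; have [y [xy Sy]] : (ball x e)^° `&` S !=set0.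
    apply: dS; last exact: open_interior.
    by exists x; apply: nbhs_singleton; apply: nbhs_interior; exact:
      nbhsx_ballx.
  have [n _ sny] := Ss _ Sy; exists n; rewrite sny metric_sym.
  by move/interior_subset : xy; rewrite ballEmdist.
have mimage A : measurable A -> measurable ((distances s \o f) @` A).
  by move=> mA; rewrite -image_comp; apply: measurable_image_distances => //;
    apply/f_meas.
have inj : injective (distances s \o f).
  move=> x y /(distances_inj s_dense); apply: f_inj; exact: in_setT.
pose r (y : paths R) : T :=
  if pselect (exists x, distances s (f x) = y) is left H then sval (cid H) else
    point.
have rK : cancel (distances s \o f) r.
  move=> x; rewrite /r; case: pselect => [H|[]]; last by exists x.
  by apply: inj; rewrite /=; case: cid.
exists (distances s \o f), r; split => //.
- apply: measurable_fun_paths => n.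
  apply: (@measurability _ _ T R setT _ _ (RGenOpens.measurableE R)) => _ [_ [x
    [y ->]] <-].
  (* [f_meas] asks for a Borel image: it is the trace on [Y] of a set that is open by continuity of
     the distance to [s n]. *)
  rewrite setTI; apply/f_meas.
  rewrite (_ : f @` _ = Y `&` (fun z => mdist (s n) z) @^-1` `]x, y[).
    apply: borelI => //; apply: sub_sigma_algebra.
    rewrite openE => z; rewrite /interior /= in_itv/= => /andP[xz zy].
    apply/nbhs_ballP; exists (Num.min (mdist (s n) z - x) (y - mdist (s n) z))%R
      => /=.
      by rewrite lt_min !subr_gt0 xz.
    move=> w; rewrite ballEmdist/= lt_min in_itv/= => /andP[zw1 zw2].
    have := metric_triangle (s n) z w.
    have := metric_triangle (s n) w z; rewrite [mdist w z]metric_sym.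
    by move=> h1 h2; apply/andP; split; lra.
  apply/seteqP; split=> [_ [t txy <-]|z [Yz zxy]]; first by split => //; exact:
    f_fun.
  by have [t _ tz] := f_surj _ Yz; exists t => //; rewrite -tz in zxy.
- move=> _ A mA; rewrite setTI.
  (* Off the range [r] is constantly [point], so the complement of the range is included exactly
     when [point] lies in [A]. *)
  rewrite (_ : r @^-1` A = (distances s \o f) @` A `|`
      ((if `[< A point >] then setT else set0) `\` (distances s \o f) @` setT)).
    apply: measurableU; first exact: mimage.
    by apply: measurableD; [case: ifP => _|exact: mimage].
  apply/seteqP; split=> [y Ay|y [[x Ax <-]|[+ ny]]]; last 2 first.
  + by rewrite /= rK.
  + rewrite /= {1}/r; case: pselect => [[x xy]|_]; last by case: asboolP.
    by exfalso; apply: ny; exists x.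
  have [[x xy]|ny] := pselect (exists x, distances s (f x) = y).
    by left; exists x => //; rewrite -(rK x) /= xy.
  right; split; last by move=> [x _ xy]; apply: ny; exists x.
  by move: Ay; rewrite /= /r; case: pselect => // _ Ap; rewrite asboolT.
Qed.
(** * The space of laws is standard Borel *)

Lemma measurable_borelE (R : realType) (A : set R) :
  measurable A <-> <<s (@open R) >> A.
Proof.
split.
- have -> : @measurable _ R = <<s @RGenOpens.G R >> := RGenOpens.measurableE R.
  move: A; apply: smallest_sub; first exact: smallest_sigma_algebra.
  by move=> _ [x [y ->]]; apply: sub_sigma_algebra; exact: interval_open.
- move: A; apply: smallest_sub; first exact: sigma_algebra_measurable.
  exact: open_measurable.
Qed.

Lemma polish_real (R : realType) : polish (R^o : metricType R).
Proof.
split.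
  move=> F PF cF; exists (lim F).
  by apply: (@cauchy_cvg R^o).
exists (range (ratr : rat -> R)); last exact: dense_rat.
apply: (card_le_trans (card_image_le _ _)); exact: countableP.
Qed.

(** The Polish space is the line and [Y] is the range of [e]; [imE] makes images under [e]
    measurable by writing them with preimages under measurable maps. *)
Lemma retract_standard_borel (R : realType) d (T : measurableType d) :
  measurable_retract T R -> standard_borel R T.
Proof.
move=> [e [r [me mr er]]].
exists R^o, (range e), e.
have imE A : e @` A = [set x | e (r x) == x] `&` r @^-1` A.
  apply/seteqP; split=> [_ [x Ax <-]|x [/= /eqP exr Ar]]; last by exists (r x).
  by split; rewrite /= er.
have mim A : measurable A -> measurable (e @` A).
  move=> mA; rewrite imE; apply: measurableI.
    rewrite -[X in measurable X]setTI.
    apply: (@measurable_fun_eqr _ _ R setT (e \o r) id) => //.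
    exact: measurableT_comp.
  by rewrite -[X in measurable X]setTI; exact: mr.
split.
- exact: polish_real.
- by apply/measurable_borelE; exact: mim.
- split; [move=> x _|move=> x y _ _ /(can_inj er)|]; last 2 first.
  + by [].
  + by [].
  + by exists x.
- move=> A; split=> [/mim/measurable_borelE//|/measurable_borelE mA].
  rewrite (_ : A = e @^-1` (e @` A)); last first.
    apply/seteqP; split=> [x Ax|x [y Ay /(can_inj er) <-]//]; first by exists x.
  by rewrite -[X in measurable X]setTI; exact: me.
Qed.

Lemma measurable_law_eval d (T : measurableType d) (R : realType) (B : set T) :
  measurable B -> measurable_fun [set: law T R] (fun mu : law T R => mu B).
Proof.
move=> mB _ D mD; apply: sub_sigma_algebra.
by exists B => //; exists D.
Qed.

Lemma measurable_fun_law d1 (S : measurableType d1) d (T : measurableType d)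
    (R : realType) (f : S -> law T R) :
  (forall B, measurable B -> measurable_fun [set: S] (fun x => f x B)) ->
  measurable_fun [set: S] f.
Proof.
move=> mf.
apply: (@measurability _ _ S (law T R) setT f (@evaluation_sets _ T R)) => //.
move=> _ [_ [B mB [D mD <-]] <-]; rewrite !setTI.
by rewrite -[X in measurable X]setTI; exact: mf.
Qed.

Section law_map.
Context d1 (T : measurableType d1) d2 (U : measurableType d2) (R : realType).
Variables (f : T -> U) (mf : measurable_fun [set: T] f).

Definition law_map (mu : probability T R) : law U R :=
  law_of (distribution mu (mfun_Sub (mem_set mf))).

Lemma law_mapE mu B : measurable B -> law_map mu B = mu (f @^-1` B).
Proof. by move=> mB; rewrite /law_map law_ofE. Qed.

End law_map.

Lemma measurable_retract_law (R : realType) d1 (T : measurableType d1)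
    d2 (U : measurableType d2) :
  measurable_retract T U -> measurable_retract (law T R) (law U R).
Proof.
move=> [e [r [me mr er]]].
have mmap d3 (V1 : measurableType d3) d4 (V2 : measurableType d4)
    (f : V1 -> V2) (mf : measurable_fun [set: V1] f) :
    measurable_fun [set: law V1 R] (fun mu => law_map mf (mu : law V1 R)).
  apply: measurable_fun_law => B mB.
  under eq_fun do rewrite law_mapE//.
  by apply: measurable_law_eval; rewrite -[X in measurable X]setTI; exact: mf.
exists (fun mu => law_map me (mu : law T R)), (fun mu => law_map mr (mu : law U
  R)).
split; [exact: mmap|exact: mmap|move=> mu].
apply: law_eqP => B mB; rewrite !law_mapE//.
  by congr (mu _); apply/seteqP; split=> x /=; rewrite er.
by rewrite -[X in measurable X]setTI; exact: mr.
Qed.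

(** * Laws on the line and their quantile functions *)

Section quantile.
Variable R : realType.

(* F gives the values at the rationals of the distribution function
   x |-> mu ]-oo, x[ ; for F arbitrary the result is a junk value, but it is
   jointly measurable in F and u. *)
Definition quantile (Fu : paths R * measurableTypeR R) : R :=
  fine (einfs (fun n => if (Fu.2 <= Fu.1 n)%R
    then (ratr (rational_seq n))%:E else +oo) 0%N).

Lemma measurable_quantile : measurable_fun [set: paths R * measurableTypeR R]
  quantile.
Proof.
apply: measurableT_comp => //.
apply: (@measurable_fun_einfs _ _ _ _ (fun n (Fu : paths R * measurableTypeR R)
  =>
  if (Fu.2 <= Fu.1 n)%R then (ratr (rational_seq n))%:E else +oo)) => n.
apply: measurable_fun_ifT => //.
apply: (@measurable_fun_ler _ _ R setT (fun Fu : paths R * measurableTypeR R =>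
  (Fu.2 : R))
  (fun Fu => Fu.1 n)); first exact: measurable_snd.
by apply: (@measurableT_comp _ _ _ _ (paths R) _ (fun x : paths R => x n) _ fst)
  => //; exact: measurable_fun_coord.
Qed.

Lemma measurable_quantile_l (F : paths R) :
  measurable_fun [set: measurableTypeR R] (fun u => quantile (F, u)).
Proof.
apply: (measurableT_comp (g := fun u => (F, u)) measurable_quantile).
exact: measurable_fun_pair.
Qed.

Let unif : probability (measurableTypeR R) R := uniform_prob (@ltr01 R).

Definition quantile_law (F : paths R) : law R R :=
  law_map (measurable_quantile_l F) unif.

(** The mass of [B] is the uniform measure of a section of the preimage of [B] under [quantile]; by
    joint measurability it depends measurably on the parameter. *)
Lemma measurable_quantile_law : measurable_fun [set: paths R] quantile_law.
Proof.
apply: measurable_fun_law => B mB; under eq_fun do rewrite law_mapE//.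
have mS : measurable (quantile @^-1` B).
  by rewrite -[X in measurable X]setTI; exact: measurable_quantile.
have := measurable_fun_xsection unif mS.
by congr measurable_fun; apply/funext => F /=; congr (unif _); rewrite
  xsectionE.
Qed.

Lemma law_real_eq (mu nu : law R R) :
  (forall x, mu `]-oo, x[%classic = nu `]-oo, x[%classic) -> mu = nu.
Proof.
move=> munu; apply: law_eqP => B mB.
apply: (@measure_unique _ R R (@RGenInftyO.G R) (fun k => `]-oo, k%:R[%classic))
  => //.
- exact: RGenInftyO.measurableE.
- move=> _ _ [x ->] [y ->]; exists (Num.min x y).
  apply/seteqP; split=> z /=; rewrite !in_itv/= lt_min.
    by move=> [-> ->].
  by move=> /andP[].
- by move=> k; exists k%:R.
- apply/seteqP; split=> // x _; exists (Num.truncn x).+1 => //=.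
  by rewrite in_itv/= truncnS_gt.
- by move=> _ [x ->]; exact: munu.
- by move=> k; rewrite (le_lt_trans (probability_le1 _ _))// ltry.
Qed.

Definition cdf_rational (mu : law R R) : paths R :=
  fun n => fine (mu `]-oo, ratr (rational_seq n)[%classic).

Lemma measurable_cdf_rational : measurable_fun [set: law R R] cdf_rational.
Proof.
apply: measurable_fun_paths => n; apply: measurableT_comp => //.
by apply: measurable_law_eval.
Qed.

Lemma unifE (A : set R) : measurable A ->
  unif A = lebesgue_measure (A `&` `[0%R, 1%R]%classic).
Proof.
move=> mA; rewrite -[in LHS](setIT A) -integral_indic// /unif.
rewrite integral_uniform//.
  rewrite subr0 invr1 mul1e integral_indic//.
exact/measurable_EFinP.
Qed.

Lemma measure_bigcup_gt d (T : measurableType d) (mu : probability T R)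
    (F : (set T)^nat) (u : \bar R) :
  (forall k, measurable (F k)) -> nondecreasing_seq F ->
  u < mu (\bigcup_k F k) -> exists k, u < mu (F k).
Proof.
move=> mF ndF; apply: contraPP => /forallNP muF; apply/negP; rewrite -leNgt.
have muFcvg := @nondecreasing_cvg_mu _ _ _ mu _ mF (bigcupT_measurable _ mF)
  ndF.
have /cvg_lim <- // := muFcvg.
apply: lime_le; first by apply/cvg_ex; eexists; exact: muFcvg.
by apply: nearW => k; rewrite leNgt; apply/negP; exact: muF.
Qed.

Lemma cdf_rationalE (mu : law R R) n :
  (cdf_rational mu n)%:E = mu `]-oo, ratr (rational_seq n)[%classic.
Proof. by rewrite fineK// fin_num_measure. Qed.

(** By continuity from below, a ray ending at x - 1/(k+1) already has mass above [u]; a rational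
    between that end and [x] serves. *)
Lemma measure_ray_gt (mu : law R R) (u x : R) :
  u%:E < mu `]-oo, x[%classic ->
  exists n, (ratr (rational_seq n) < x)%R /\ (u <= cdf_rational mu n)%R.
Proof.
pose F k := `]-oo, (x - k.+1%:R^-1)%R[%classic.
have -> : `]-oo, x[%classic = \bigcup_k F k.
  apply/seteqP; split=> [y|y [k _]]; rewrite /F /= !in_itv/= => yx.
    exists (Num.truncn (x - y)^-1) => //=.
    rewrite in_itv/= ltrBrDr -ltrBrDl invf_plt ?posrE ?subr_gt0//.
    exact: truncnS_gt.
  by apply: (lt_le_trans yx); rewrite lerBlDr lerDl.
move=> /measure_bigcup_gt[k|m n mn|k uk]; first exact: measurable_itv.
  apply/subsetPset => y; rewrite /F /= !in_itv/= => /lt_le_trans; apply.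
  by rewrite lerD2l lerN2 lef_pV2 ?posrE// ler_nat.
have [n /andP[kn nx]] : exists n, (x - k.+1%:R^-1 < ratr (rational_seq n) <
  x)%R.
  by apply: rational_seq_between; rewrite ltrBlDr ltrDl.
exists n; split => //; rewrite -lee_fin cdf_rationalE (le_trans (ltW uk))//.
apply: le_measure; rewrite ?inE//; first exact: measurable_itv.
move=> y; rewrite /F /= !in_itv/= => /lt_trans.
exact.
Qed.

(** The equivalence holds for the extended infimum ([vlt]). It remains to see that this infimum is
    finite, so that [fine] does no harm: [u < 1] gives the upper bound [y], and [0 < u] the lower
    bound [z]. *)
Lemma quantile_ltP (mu : law R R) (u x : R) : (0 < u < 1)%R ->
  (quantile (cdf_rational mu, u) < x)%R <->
  exists n, (ratr (rational_seq n) < x)%R /\ (u <= cdf_rational mu n)%R.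
Proof.
move=> /andP[u0 u1].
rewrite /quantile; set v := (X in einfs X); pose l := einfs v 0%N.
have vlt y : l < y%:E <->
    exists n, (ratr (rational_seq n) < y)%R /\ (u <= cdf_rational mu n)%R.
  rewrite einfs0_lt /v/=; split=> -[n]; first by case: ifP => // un; exists n.
  by move=> [ny un]; exists n; rewrite un lte_fin.
have [y uy] : exists y, u%:E < mu `]-oo, y[%classic.
  pose F k := `]-oo, (k%:R : R)[%classic.
  have [k|m n mn||k uk] := @measure_bigcup_gt _ _ mu F u%:E.
  - exact: measurable_itv.
  - apply/subsetPset => w; rewrite /F /= !in_itv/= => /lt_le_trans; apply.
    by rewrite ler_nat.
  - rewrite (_ : \bigcup_k _ = setT) ?probability_setT ?lte_fin//.
    apply/seteqP; split=> // w _; exists (Num.truncn w).+1 => //=.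
    by rewrite /F /= in_itv/= truncnS_gt.
  - by exists k%:R.
have lty : l < y%:E by apply/vlt/measure_ray_gt.
have [z zu] : exists z, mu `]-oo, z[%classic < u%:E.
  pose F k := `[(- k%:R : R)%R, +oo[%classic.
  have [k|m n mn||k uk] := @measure_bigcup_gt _ _ mu F (1 - u)%:E.
  - exact: measurable_itv.
  - apply/subsetPset => w; rewrite /F /= !in_itv/= !andbT; apply: le_trans.
    by rewrite lerN2 ler_nat.
  - rewrite (_ : \bigcup_k _ = setT) ?probability_setT ?lte_fin ?ltrBlDr
      ?ltrDl//.
    apply/seteqP; split=> // w _; exists (Num.truncn (- w)).+1 => //=.
    by rewrite /F /= in_itv/= andbT lerNl ltW// truncnS_gt.
  - exists (- k%:R)%R; rewrite -setCitvr probability_setC//.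
    by rewrite lteBlDr ?fin_num_measure// addeC -lteBlDr// -EFinB.
have lz : z%:E <= l.
  rewrite leNgt; apply/negP => /vlt[n [nz]]; rewrite -lee_fin cdf_rationalE.
  apply/negP; rewrite -ltNge; apply: le_lt_trans zu.
  apply: le_measure; rewrite ?inE// => w /=; rewrite !in_itv/= => /lt_trans.
  exact.
have lfin : l \is a fin_num.
  by rewrite fin_numElt (lt_le_trans _ lz) ?ltNyr// (lt_trans lty)// ltry.
by rewrite -lte_fin fineK//; exact: vlt.
Qed.

(** Inverse transform sampling: the quantile function of a uniform variable has law [mu]. Inside ]0,
    1[ the quantile at [u] is below [x] if [u < s] and only if [u <= s], where [s] is the mass of
    the ray up to [x]. *)
Lemma quantile_lawK : cancel cdf_rational quantile_law.
Proof.
move=> mu; apply: law_real_eq => x; rewrite law_mapE//.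
set A := _ @^-1` _.
have mA : measurable A.
  by rewrite -[X in measurable X]setTI; exact: measurable_quantile_l.
have [s muE] : exists s, mu `]-oo, x[%classic = s%:E.
  by exists (fine (mu `]-oo, x[%classic)); rewrite fineK// fin_num_measure.
have s0 : (0 <= s)%R by rewrite -lee_fin -muE.
have s1 : (s <= 1)%R by rewrite -lee_fin -muE probability_le1.
(* ]0, s[ is included in A, and A `&` [0, 1] in [0, s] up to the point 1. *)
rewrite unifE// muE; apply/eqP; rewrite eq_le; apply/andP; split.
- apply: (@le_trans _ _ (lebesgue_measure (`[0%R, s] `|` [set 1%R] : set R))).
    apply: le_measure; rewrite ?inE//; first exact: measurableI.
      exact: measurableU.
    move=> u [/= Au]; rewrite !in_itv/= => /andP[u0 u1].
    (* [quantile_ltP] covers only [u] strictly between 0 and 1; the point 0 lies in [0, s] anyway,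
       and 1 is the added null set. *)
    have [->|un1] := eqVneq u 1%R; first by right.
    have [->|un0] := eqVneq u 0%R; first by left; rewrite lexx s0.
    left; rewrite u0/=.
    have /quantile_ltP : (0 < u < 1)%R by rewrite !lt_neqAle un1 u0 u1 eq_sym
      un0.
    move=> /(_ mu x)[+ _]; move: Au; rewrite /A /= in_itv/= => Au /(_ Au)[n [nx
      un]].
    rewrite -lee_fin -muE (@le_trans _ _ (cdf_rational mu n)%:E)//.
    rewrite cdf_rationalE; apply: le_measure; rewrite ?inE// => w /=.
    by rewrite !in_itv/= => /lt_trans; exact.
  apply: (@le_trans _ _ (lebesgue_measure (`[0%R, s] : set R) +
    lebesgue_measure [set (1%R : R)])); first exact: measureU2.
  by rewrite lebesgue_measure_set1 adde0 lebesgue_measure_itv/= lte_fin; case: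
    ifP => _; rewrite ?sube0 ?lee_fin.
- apply: (@le_trans _ _ (lebesgue_measure (`]0%R, s[ : set R))).
    by rewrite lebesgue_measure_itv/= lte_fin; case: ifPn; rewrite ?sube0//
      -leNgt lee_fin.
  apply: le_measure; rewrite ?inE//; first exact: measurableI.
  move=> u /=; rewrite !in_itv/= => /andP[u0 us].
  have u1 : (u < 1)%R by exact: lt_le_trans s1.
  split; last by rewrite !ltW.
  rewrite /A /= in_itv/=; apply/quantile_ltP; first by rewrite u0.
  by apply: measure_ray_gt; rewrite muE lte_fin.
Qed.

End quantile.

Lemma measurable_retract_law_real (R : realType) :
  measurable_retract (law R R) (paths R).
Proof.
exists (@cdf_rational R), (@quantile_law R); split.
- exact: measurable_cdf_rational.
- exact: measurable_quantile_law.
- exact: quantile_lawK.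
Qed.

(** Paths code as single reals, so their laws code as laws on the line; these become real sequences
    through their distribution functions, and then reals. *)
Lemma measurable_retract_law_paths (R : realType) d (W : measurableType d) :
  standard_borel R W -> measurable_retract (law (paths W) R) R.
Proof.
move=> hW; apply: (measurable_retract_trans _ (measurable_retract_real_paths
  R)).
apply: (measurable_retract_trans _ (measurable_retract_law_real R)).
apply: measurable_retract_law.
apply: (measurable_retract_trans _ (measurable_retract_real_paths R)).
apply: (measurable_retract_trans _ (measurable_retract_paths2 R)).
exact/measurable_retract_paths/standard_borel_retract.
Qed.

Lemma standard_borel_law_paths (R : realType) d (W : measurableType d) :
  standard_borel R W -> standard_borel R (law (paths W) R).
Proof. by move=> hW; exact/retract_standard_borel/measurable_retract_law_paths.
  Qed.
(** * Disintegration and conditional probabilities *)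

Section law_kernel.
Context d1 (E : measurableType d1) d2 (F : measurableType d2) (R : realType).
Variable k : E -> law F R.
Hypothesis mk : measurable_fun [set: E] k.

(** The law of a pair whose first component is frozen at [x]. In the Giry monad, its measurability
    in [x] and its mixtures come from the monad operations. *)
Definition law_graph (x : E) : giry (E * F)%type R :=
  giry_prod (giry_ret x : giry E R, (k x : probability F R) : giry F R).

Lemma measurable_law_graph : measurable_fun [set: E] law_graph.
Proof.
apply: (measurableT_comp measurable_giry_prod).
apply: measurable_fun_pair; first exact: measurable_giry_ret.
apply: measurable_giry_codensity => // B mB.
have := measurableT_comp (@measurable_law_eval _ F R B mB) mk.
exact.
Qed.

Lemma integral_law_graph (phi : E * F -> \bar R) x :
  measurable_fun [set: E * F] phi -> (forall z, 0 <= phi z) ->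
  giry_int (law_graph x) phi = \int[k x]_y phi (x, y).
Proof.
move=> mphi phi0; rewrite /giry_int /law_graph /giry_prod.
transitivity (\int[(giry_ret x : giry E R) \x ((k x : probability F R) : giry F
  R)]_z phi z).
  by apply: eq_measure_integral => A mA _.
rewrite fubini_tonelli1// integral_dirac//; last exact:
  measurable_fun_fubini_tonelli_F.
by rewrite diracT mul1e.
Qed.

(** Both the measure and the integrand depend on [x]; [law_graph] moves the two dependences into the
    measure. *)
Lemma measurable_law_integral (phi : E * F -> \bar R) :
  measurable_fun [set: E * F] phi -> (forall z, 0 <= phi z) ->
  measurable_fun [set: E] (fun x => \int[k x]_y phi (x, y)).
Proof.
move=> mphi phi0.
have := measurableT_comp (measurable_giry_int mphi phi0) measurable_law_graph.
by apply: eq_measurable_fun => x _; rewrite /= integral_law_graph.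
Qed.

End law_kernel.

Lemma measurable_fun_preimage d1 (T : measurableType d1) d2 (U : measurableType
  d2)
    (f : T -> U) B :
  measurable_fun [set: T] f -> measurable B -> measurable (f @^-1` B).
Proof. by move=> mf mB; rewrite -[X in measurable X]setTI; exact: mf. Qed.

Section disintegration.
Context d (Omega : measurableType d) (R : realType) (P : probability Omega R).
Context d1 (E : measurableType d1) d2 (F : measurableType d2).
Variables (Y : Omega -> F) (H : Omega -> E) (k : E -> law F R).
Hypotheses (mY : measurable_fun [set: Omega] Y) (mH : measurable_fun [set:
  Omega] H).
Hypothesis kP : regular_cond_law P Y H k.

Let mk := kP.1.

Let mHY : measurable_fun [set: Omega] (fun w => (H w, Y w)).
Proof. exact: measurable_fun_pair. Qed.

Let mgraph : measurable_fun [set: Omega] (law_graph k \o H).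
Proof. exact: measurableT_comp (measurable_law_graph mk) mH. Qed.

(** The two sides integrate [phi] against the joint law of [H] and [Y] and against the mixture of
    the measures [law_graph k (H w)]. These agree on rectangles, a generating family stable under
    intersection. *)
Lemma regular_cond_law_integral (phi : E * F -> \bar R) :
  measurable_fun [set: E * F] phi -> (forall z, 0 <= phi z) ->
  \int[P]_w phi (H w, Y w) = \int[P]_w \int[k (H w)]_y phi (H w, y).
Proof.
move=> mphi phi0.
transitivity (giry_int (giry_map mHY (P : giry Omega R)) phi).
  by rewrite giry_int_map.
transitivity (giry_int (giry_bind (P : giry Omega R) mgraph) phi); last first.
  rewrite giry_int_bind//; apply: eq_integral => w _ /=.
  exact: integral_law_graph.
apply: eq_measure_integral => S mS _.
apply: (@measure_unique _ _ _
  [set A `*` B | A in measurable & B in measurable] (fun=> setT)) => //.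
- exact: measurable_prod_measurableType.
- move=> _ _ [A1 mA1 [A2 mA2 <-]] [B1 mB1 [B2 mB2 <-]].
  exists (A1 `&` B1); first exact: measurableI.
  exists (A2 `&` B2); first exact: measurableI.
  by rewrite setXI.
- by move=> _; exists setT => //; exists setT => //; rewrite setXTT.
- by apply/seteqP; split=> // x _; exists 0%N.
- move=> _ [A mA [B mB <-]].
  rewrite /giry_bind /=.
  transitivity (P (H @^-1` A `&` Y @^-1` B)); first by [].
  (* This is the defining identity of [kP] on the event that [H] lies in [A]; off this event
     [law_graph] gives the rectangle mass 0. *)
  have [_ _ <-] := kP.2 B mB; last by exists A => //; rewrite setTI.
  transitivity (giry_int (P : giry Omega R) ((giry_ev ^~ (A `*` B)) \o
    (law_graph k \o H))).
    rewrite /giry_int integral_mkcond; apply: eq_integral => w _ /=.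
    rewrite /giry_ev patchE.
    have mAB : measurable (A `*` B) by exact: measurableX.
    transitivity (giry_int (law_graph k (H w)) (fun z => (\1_(A `*` B) z)%:E)).
      rewrite integral_law_graph//.
      have [wA|wA] := boolP (w \in H @^-1` A).
      + rewrite -[in LHS](setIT B) -integral_indic//; apply: eq_integral => y _.
          congr (_%:E); rewrite !indicE; congr ((_ : bool)%:R).
          apply/idP/idP; rewrite !inE; first by move=> By; split => //; rewrite
            inE in wA.
          by case.
      + rewrite integral0_eq// => y _; rewrite indicE memNset// => -[Aw _].
          by move/negP : wA; apply; rewrite inE.
      by apply/measurable_EFinP; exact: measurable_indic.
    by have := integral_indic (law_graph k (H w)) measurableT mAB; rewrite
      setIT.
  rewrite giry_int_map//.
  by apply: measurable_giry_ev; exact: measurableX.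
- by move=> k0; rewrite (le_lt_trans sprobability_setT)// ltry.
Qed.
End disintegration.
Lemma ge0_integral_mrestr d (T : measurableType d) (R : realType)
    (mu : {measure set T -> \bar R}) (D : set T) (mD : measurable D)
    (f : T -> \bar R) :
  measurable_fun [set: T] f -> (forall x, 0 <= f x) ->
  \int[mrestr mu mD]_x f x = \int[mu]_(x in D) f x.
Proof.
move=> mf f0; rewrite -(setUv D) ge0_integral_setU//; last 3 first.
- exact: measurableC.
- by rewrite setUv.
- by apply/disj_setPCl.
rewrite [X in _ + X]null_set_integral ?adde0//; last 3 first.
- exact: measurableC.
- exact: measurable_funTS.
- by transitivity (mu (~` D `&` D)); last rewrite setICl measure0.
apply: eq_measure_integral => A mA AD.
by rewrite /mrestr; congr (mu _); exact/setIidPl.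
Qed.

(** * Conditional probability given a random variable *)

Section sub_sigma_algebra.
Context d (Omega : measurableType d) (R : realType) (P : probability Omega R).
Context d' (E : measurableType d') (Z : Omega -> E).
Hypothesis mZ : measurable_fun [set: Omega] Z.

Local Notation sub := (g_sigma_algebra_preimageType Z).
Local Notation G := (g_sigma_algebra_preimage Z).

(* Omega with the sub-sigma-algebra of Z is the measurable space sub, and the
   restriction of P to it is the image of P under the identity. *)
Let inc : Omega -> sub := id.

Lemma g_sigma_algebra_preimage_sub A : G A -> measurable A.
Proof. by move=> [B mB <-]; exact: mZ. Qed.

Let minc : measurable_fun [set: Omega] inc.
Proof. by move=> _ A [B mB <-]; rewrite setTI; exact: mZ. Qed.

Let subP := distribution P (mfun_Sub (mem_set minc)).

Lemma measurable_sub_fun d2 (U : measurableType d2) (f : Omega -> U) :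
  measurable_fun [set: sub] f -> measurable_fun [set: Omega] f.
Proof. by move=> mf; exact: (measurableT_comp mf minc). Qed.

Lemma measurable_subP d2 (U : measurableType d2) (f : Omega -> U) :
  measurable_fun [set: sub] f <-> forall B, measurable B -> G (f @^-1` B).
Proof.
split=> [mf B mB|mf _ B mB]; last by rewrite setTI; exact: mf.
by have := mf measurableT B mB; rewrite setTI.
Qed.

Let subP_integrable f : measurable_fun [set: sub] f ->
  P.-integrable [set: Omega] f <-> subP.-integrable [set: sub] f.
Proof.
move=> mf; split=> [Pf|/integrableP[_ Pf]].
  exact: (integrable_pushforward minc mf Pf).
apply/integrableP; split; first exact: measurable_sub_fun.
move: Pf; rewrite [X in X < _ -> _]ge0_integral_pushforward//.
exact: measurableT_comp.
Qed.

Let subP_integral f A : measurable_fun [set: sub] f -> P.-integrable [set: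
  Omega] f ->
  G A -> \int[subP]_(w in A) f w = \int[P]_(w in A) f w.
Proof.
move=> mf Pf GA; rewrite [LHS](integral_pushforward minc)//.
by apply: (integrableS measurableT _ _ Pf) => //; exact:
  g_sigma_algebra_preimage_sub.
Qed.

(** On [sub], both versions are measurable with equal integrals over every measurable set, and a
    null set of [sub] is null for [P]. *)
Lemma cond_prob_unique (A : set Omega) f f' :
  cond_prob P G A f -> cond_prob P G A f' -> ae_eq P [set: Omega] f f'.
Proof.
move=> [/measurable_subP mf Pf fA] [/measurable_subP mf' Pf' f'A].
have [N [mN N0 fN]] : ae_eq subP [set: sub] f f'.
  apply: integral_ae_eq => //; first exact/subP_integrable.
  by move=> B _ mB; rewrite !subP_integral// fA// f'A.
exists N; split => //; exact: g_sigma_algebra_preimage_sub.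
Qed.

(** [f] is the Radon-Nikodym derivative, on [sub], of the measure sending [B] to the probability of
    [B] and [A]; the last clause is the change of variables for this density. *)
Lemma ge0_cond_prob_exists (A : set Omega) : measurable A ->
  exists f : Omega -> \bar R, [/\ cond_prob P G A f, forall w, 0 <= f w &
    forall phi : Omega -> \bar R, measurable_fun [set: sub] phi ->
      (forall w, 0 <= phi w) ->
      \int[P]_w (phi w * f w) = \int[P]_(w in A) phi w].
Proof.
move=> mA.
pose nu := pushforward (mrestr P mA) inc.
pose nuM0 : {measure set sub -> \bar R} := nu.
pose nuM := nuM0 minc.
have nu_fin : fin_num_fun nu.
  move=> B mB; rewrite /nu /pushforward /mrestr fin_num_measure//.
  by apply: measurableI => //; exact: g_sigma_algebra_preimage_sub.
pose nuF : {finite_measure set sub -> \bar R} :=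
  HB.pack (nuM : set sub -> \bar R) (Measure.class nuM) (Measure_isFinite.Build
    _ _ _ nuM nu_fin).
have numu : nuF `<< subP.
  apply/null_content_dominatesP => B mB PB0.
  apply/eqP; rewrite eq_le measure_ge0 andbT.
  rewrite -[leRHS]PB0; apply: le_measure; rewrite ?inE.
  - by apply: measurableI => //; exact: g_sigma_algebra_preimage_sub.
  - exact: g_sigma_algebra_preimage_sub.
  - by move=> x [].
pose f : Omega -> \bar R := Radon_Nikodym_SigmaFinite.f nuF subP.
have f0 w : 0 <= f w by exact: Radon_Nikodym_SigmaFinite.f_ge0.
have intf := Radon_Nikodym_SigmaFinite.f_integrable numu.
have mf : measurable_fun [set: sub] f by exact: measurable_int intf.
have Pf : P.-integrable [set: Omega] f by exact/subP_integrable.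
exists f; split => //.
- split => //; first exact/measurable_subP.
  move=> B mB; rewrite -subP_integral//.
  rewrite -(Radon_Nikodym_SigmaFinite.f_integral numu mB).
  by [].
- move=> phi mphi phi0.
  transitivity (\int[subP]_w (phi w * f w)).
    rewrite [RHS]ge0_integral_pushforward//.
    - exact: emeasurable_funM.
    - by move=> w _; exact: mule_ge0.
  rewrite Radon_Nikodym_SigmaFinite.change_of_variables//.
  transitivity (\int[nu]_w phi w); first exact: eq_measure_integral.
  rewrite ge0_integral_pushforward//= preimage_setT.
  by rewrite ge0_integral_mrestr//; exact: measurable_sub_fun.
Qed.

Lemma cond_prob_pull_out (A : set Omega) f phi : measurable A ->
  cond_prob P G A f -> measurable_fun [set: sub] phi -> (forall w, 0 <= phi w)
    ->
  \int[P]_w (phi w * f w) = \int[P]_(w in A) phi w.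
Proof.
move=> mA fA mphi phi0.
have [g [gA g0 <-//]] := ge0_cond_prob_exists mA.
have [/measurable_subP mf _ _] := fA; have [/measurable_subP mg _ _] := gA.
apply: ae_eq_integral => //.
- by apply: emeasurable_funM; exact: measurable_sub_fun.
- by apply: emeasurable_funM; exact: measurable_sub_fun.
- by apply: filterS (cond_prob_unique fA gA) => w /= /[apply] ->.
Qed.

End sub_sigma_algebra.
(* Through an embedding of the path space in R, the sets B n are the preimages
   of the rational rays, and r is built from quantile functions. *)
Lemma law_paths_coding (R : realType) d (W : measurableType d) :
  standard_borel R W ->
  exists (B : (set (paths W))^nat) (r : paths R -> law (paths W) R),
    [/\ forall n, measurable (B n), measurable_fun [set: paths R] r &
        forall mu : law (paths W) R, r (fun n => fine (mu (B n))) = mu].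
Proof.
move=> hW.
have [e [r [me mr er]]] : measurable_retract (paths W) R.
  apply: (measurable_retract_trans _ (measurable_retract_real_paths R)).
  apply: (measurable_retract_trans _ (measurable_retract_paths2 R)).
  exact/measurable_retract_paths/standard_borel_retract.
exists (fun n => e @^-1` `]-oo, ratr (rational_seq n)[%classic),
  (fun x => law_map mr (quantile_law x)); split.
- by move=> n; apply: measurable_fun_preimage.
- apply: measurable_fun_law => B mB; under eq_fun do rewrite law_mapE//.
  have mrB := measurable_fun_preimage mr mB.
  have := measurableT_comp (@measurable_law_eval _ R R _ mrB)
    (@measurable_quantile_law R).
  exact.
- move=> mu; rewrite (_ : (fun _ => _) = cdf_rational (law_map me mu)); last
    first.
    by apply/funext => n; rewrite /cdf_rational law_mapE.
  rewrite quantile_lawK; apply: law_eqP => B mB.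
  rewrite !law_mapE//; last exact: measurable_fun_preimage.
  by congr (mu _); apply/seteqP; split=> x /=; rewrite er.
Qed.

Lemma law_paths_determined (R : realType) d (W : measurableType d) :
  standard_borel R W ->
  exists2 B : (set (paths W))^nat, (forall n, measurable (B n)) &
    forall mu nu : law (paths W) R, (forall n, mu (B n) = nu (B n)) -> mu = nu.
Proof.
move=> /law_paths_coding[B [r [mB _ rK]]]; exists B => // mu nu munu.
by rewrite -(rK mu) -(rK nu); congr r; apply/funext => n; rewrite munu.
Qed.

(** The n-th bit of the code of [f] indicates an event of the form Z in [D n]; decoding the bits
    given by the sets [D n] yields [h]. *)
Lemma doob_dynkin d (Omega : measurableType d) d1 (T : measurableType d1)
    d2 (V : measurableType d2) (Z : Omega -> T) (f : Omega -> V) :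
  measurable_retract V (paths bool) ->
  (forall B, measurable B -> g_sigma_algebra_preimage Z (f @^-1` B)) ->
  exists2 h : T -> V, measurable_fun [set: T] h & f = h \o Z.
Proof.
move=> [e [r [me mr er]]] mf.
have /choice[D DP] n : exists D : set T, measurable D /\
    Z @^-1` D = [set w | e (f w) n].
  have [|D mD DE] := mf (e @^-1` [set x : paths bool | x n]); last first.
    by exists D; split=> //; rewrite -[RHS]DE setTI.
  apply: measurable_fun_preimage => //.
  rewrite -[X in measurable X]setTI.
  exact: (@measurable_fun_coord _ bool n measurableT [set true]).
exists (fun t => r (fun n => `[< D n t >])).
  apply: (measurableT_comp mr); apply: measurable_fun_paths => n.
  apply: measurable_fun_bool_set; rewrite (_ : [set x | _] = D n).
    by have [] := DP n.
  by apply/seteqP; split => x /asboolP.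
apply/funext => w /=; rewrite -(er (f w)); congr r; apply/funext => n.
have [_ DE] := DP n; have -> : D n (Z w) = e (f w) n.
  by transitivity ((Z @^-1` D n) w); last rewrite DE.
by rewrite asboolb.
Qed.

Lemma cond_prob_coarser d (Omega : measurableType d) (R : realType)
    (P : probability Omega R) (G G' : set_system Omega) A f :
  G' `<=` G -> (forall B, measurable B -> G' (f @^-1` B)) ->
  cond_prob P G A f -> cond_prob P G' A f.
Proof. by move=> G'G mf [_ Pf fA]; split => // B /G'G; exact: fA. Qed.

Lemma g_sigma_algebra_preimage_comp d (Omega : measurableType d)
    d1 (T : measurableType d1) d2 (U : measurableType d2)
    (Z : Omega -> T) (k : T -> U) : measurable_fun [set: T] k ->
  g_sigma_algebra_preimage (k \o Z) `<=` g_sigma_algebra_preimage Z.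
Proof.
move=> mk _ [B mB <-]; exists (k @^-1` B); first exact: measurable_fun_preimage.
by rewrite !setTI comp_preimage.
Qed.

(** * Sufficiency and minimality *)

Section sufficiency.
Context d (Omega : measurableType d) (R : realType) (P : probability Omega R).
Context d1 (E : measurableType d1) d2 (F : measurableType d2).
Variables (Y : Omega -> F) (H : Omega -> E) (k : E -> law F R).
Hypotheses (mY : measurable_fun [set: Omega] Y) (mH : measurable_fun [set:
  Omega] H).
Hypothesis kP : regular_cond_law P Y H k.

Let mk := kP.1.
Let mkH : measurable_fun [set: Omega] (k \o H).
Proof. exact: measurableT_comp. Qed.

Lemma cond_prob_predictive B : measurable B ->
  cond_prob P (g_sigma_algebra_preimage (k \o H)) (Y @^-1` B) (fun w => k (H w)
    B).
Proof.
move=> mB; apply: cond_prob_coarser (kP.2 B mB).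
  exact: g_sigma_algebra_preimage_comp.
move=> D mD; exists [set mu : law F R | D (mu B)]; last by rewrite setTI.
exact: (measurable_fun_preimage (@measurable_law_eval _ F R B mB)).
Qed.

(** On an event [D] generated by the state, the factor [k (H w) B] cut to [D] is pulled out of [g].
    What remains is its integral over the intersection of [D] with the past event; [H] generates
    this intersection, so [kP] evaluates it. *)
Lemma predictive_sufficient : cond_indep P Y H (k \o H).
Proof.
move=> B A mB mA; have fP := cond_prob_predictive mB.
have [|g [gP g0 _]] := @ge0_cond_prob_exists _ _ _ P _ _ _ mkH (H @^-1` A).
  exact: measurable_fun_preimage.
exists (fun w => k (H w) B), g; split => //.
have [/measurable_subP mf Pf _] := fP; have [/measurable_subP mg Pg _] := gP.
split.
- by apply/measurable_subP; exact: emeasurable_funM.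
- apply: (le_integrable _ _ _ Pg) => //.
    by apply: emeasurable_funM; exact: (measurable_sub_fun mkH).
  move=> w _ /=; rewrite abseM gee0_abs// -[leRHS]mul1e lee_wpmul2r//.
  exact: probability_le1.
- move=> D GD; have mD : measurable D by exact: (g_sigma_algebra_preimage_sub
    mkH).
  transitivity (\int[P]_w (((fun w => k (H w) B) \_ D) w * g w)).
    rewrite integral_mkcond; apply: eq_integral => w _ /=.
    by rewrite !patchE; case: ifP => // _; rewrite mul0e.
  rewrite (cond_prob_pull_out mkH _ gP)//; last 3 first.
  - exact: measurable_fun_preimage.
  - have mfD := @measurable_funTS _ _ _ _ (D : set (g_sigma_algebra_preimageType
      (k \o H))) _ mf.
    by have [+ _] := @measurable_restrictT _ _ (g_sigma_algebra_preimageType (k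
      \o H))
      _ D (fun w => k (H w) B) GD; exact.
  - by move=> w; rewrite patchE; case: ifP.
  have [DE mDE DED] : g_sigma_algebra_preimage H D.
    exact: g_sigma_algebra_preimage_comp GD.
  have GHAD : g_sigma_algebra_preimage H (H @^-1` A `&` D).
    exists (A `&` DE); first exact: measurableI.
    by rewrite setTI preimage_setI -DED setTI.
  have [_ _ /(_ _ GHAD)] := kP.2 B mB.
  rewrite -integral_mkcondr => ->; congr (P _).
  by apply/seteqP; split=> w /=; tauto.
Qed.

Section minimality.
Context d3 (T : measurableType d3) (rho : E -> T).
Hypothesis mrho : measurable_fun [set: E] rho.
Hypothesis suff : cond_indep P Y H (rho \o H).

Let mrhoH : measurable_fun [set: Omega] (rho \o H).
Proof. exact: measurableT_comp. Qed.

(* Let f and g be the conditional probabilities of Y^-1 B and H^-1 A given rho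
  H.
   The integral of f over H^-1 A is the integral of f g, which by sufficiency is
   the probability of the intersection of Y^-1 B and H^-1 A: so f is a
   conditional probability given H. *)
Lemma sufficient_cond_prob B : measurable B ->
  exists f : Omega -> \bar R,
    (forall D, measurable D -> g_sigma_algebra_preimage (rho \o H) (f @^-1` D))
      /\
    ae_eq P [set: Omega] (fun w => k (H w) B) f.
Proof.
move=> mB; have mYB := measurable_fun_preimage mY mB.
have [f [fP f0 _]] := @ge0_cond_prob_exists _ _ _ P _ _ _ mrhoH _ mYB.
have [/measurable_subP mf Pf _] := fP.
exists f; split; first by case: fP.
apply: (cond_prob_unique mH (kP.2 B mB)); split => //.
  by case: fP => + _ _ => + D mD => /(_ D mD); exact:
    g_sigma_algebra_preimage_comp.
move=> _ [A mA <-]; rewrite setTI.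
have mHA := measurable_fun_preimage mH mA.
have [f' [g [f'P gP fgP]]] := suff mB mA.
have [/measurable_subP mf' _ _] := f'P; have [/measurable_subP mg _ _] := gP.
rewrite -(cond_prob_pull_out mrhoH mHA gP mf f0).
have [_ _ /(_ setT)] := fgP.
rewrite setTI setIC => <-; last by exists setT => //; rewrite setTI
  preimage_setT.
apply: ae_eq_integral => //.
- by apply: emeasurable_funM; exact: (measurable_sub_fun mrhoH).
- by apply: emeasurable_funM; exact: (measurable_sub_fun mrhoH).
- by apply: filterS (cond_prob_unique mrhoH fP f'P) => w /= /[apply] ->.
Qed.

End minimality.

End sufficiency.

(** Almost surely, each of the countably many numbers coding the state equals some [f n] measurable
    for [rho \o H]. Doob-Dynkin factors the whole sequence through [rho \o H], and decoding gives
    [g]. *)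
Lemma predictive_minimal (R : realType) d (Omega : measurableType d)
    (P : probability Omega R) d1 (E : measurableType d1) dW (W : measurableType
      dW)
    (Y : Omega -> paths W) (H : Omega -> E) (k : E -> law (paths W) R)
    d3 (T : measurableType d3) (rho : E -> T) :
  standard_borel R W ->
  measurable_fun [set: Omega] Y -> measurable_fun [set: Omega] H ->
  regular_cond_law P Y H k -> measurable_fun [set: E] rho ->
  cond_indep P Y H (rho \o H) ->
  exists2 g : T -> law (paths W) R, measurable_fun [set: T] g &
    {ae P, forall w, k (H w) = g (rho (H w))}.
Proof.
move=> hW mY mH kP mrho suff.
have [B [r [mB mr rK]]] := law_paths_coding hW.
have /choice[f fP] n := sufficient_cond_prob mY mH kP mrho suff (mB n).
pose F (w : Omega) : paths R := fun n => fine (f n w).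
have mF : measurable_fun [set: g_sigma_algebra_preimageType (rho \o H)] F.
  apply: measurable_fun_paths => n; apply: measurableT_comp => //.
  by apply/measurable_subP; have [] := fP n.
have [||h mh hE] := @doob_dynkin _ _ _ T _ (paths R) (rho \o H) F.
- apply: measurable_retract_trans (measurable_retract_paths2 bool).
  exact/measurable_retract_paths/measurable_retract_real_cantor.
- exact/measurable_subP.
exists (r \o h); first exact: measurableT_comp.
have : {ae P, forall w, forall n, k (H w) (B n) = f n w}.
  apply: ae_foralln => n; have [_ kf] := fP n.
  by apply: filterS kf => w /(_ Logic.I).
apply: filterS => w kf; rewrite -[LHS]rK /=.
have -> : h (rho (H w)) = F w by rewrite hE.
by congr r; apply/funext => n; rewrite kf.
Qed.

Lemma ae_eq_sub_mod_null d (Omega : measurableType d) (R : realType)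
    (P : probability Omega R) d1 (V : measurableType d1) d2 (T : measurableType
      d2)
    (S : Omega -> V) (Z : Omega -> T) (g : T -> V) :
  measurable_fun [set: Omega] S -> measurable_fun [set: Omega] Z ->
  measurable_fun [set: T] g -> {ae P, forall w, S w = g (Z w)} ->
  sub_mod_null P (g_sigma_algebra_preimage S) (g_sigma_algebra_preimage Z).
Proof.
move=> mS mZ mg [N [mN N0 SN]] _ [D mD <-]; rewrite setTI.
exists (Z @^-1` (g @^-1` D)).
  by exists (g @^-1` D); [exact: measurable_fun_preimage|rewrite setTI].
apply/eqP; rewrite eq_le measure_ge0 andbT -N0; apply: le_measure; rewrite
  ?inE//.
- have mSD := measurable_fun_preimage mS mD.
  have mZD := measurable_fun_preimage mZ (measurable_fun_preimage mg mD).
  by apply: measurableU; exact: measurableD.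
- move=> w Sw; apply: SN => Sg; move: Sw.
  by rewrite /setY /= Sg => -[[]|[]].
Qed.
Lemma integral_indic_mul d (T : measurableType d) (R : realType)
    (mu : {measure set T -> \bar R}) (A : set T) (f : T -> \bar R) :
  \int[mu]_x ((\1_A x)%:E * f x) = \int[mu]_(x in A) f x.
Proof.
rewrite [RHS]integral_mkcond; apply: eq_integral => x _.
by rewrite patchE indicE; case: ifP => _; rewrite ?mul1e ?mul0e.
Qed.

Lemma integrable_le1 d (T : measurableType d) (R : realType)
    (P : probability T R) (f : T -> \bar R) :
  measurable_fun [set: T] f -> (forall x, 0 <= f x <= 1) ->
  P.-integrable [set: T] f.
Proof.
move=> mf f01; apply: (le_integrable _ _ _ (finite_measure_integrable_cst P 1
  measurableT)) => //.
by move=> x _ /=; have /andP[f0 f1] := f01 x; rewrite gee0_abs// normr1.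
Qed.

(** * Recursive update and Markov property *)

Section tuple_snoc.
Context dW (W : measurableType dW) (t : nat).

(** With [tuple_unsnoc], this exchanges H_{t+1} and the pair of H_t and W_{t+1}. *)
Definition tuple_snoc (hw : t.-tuple W * W) : t.+1.-tuple W :=
  [tuple (if unlift ord_max i is Some j then tnth hw.1 j else hw.2) | i < t.+1].

Definition tuple_unsnoc (h : t.+1.-tuple W) : t.-tuple W * W :=
  ([tuple tnth h (lift ord_max i) | i < t], tnth h ord_max).

Lemma measurable_tuple_snoc : measurable_fun [set: t.-tuple W * W] tuple_snoc.
Proof.
apply/measurable_fun_tnthP => i.
rewrite (_ : _ \o _ = fun hw : t.-tuple W * W =>
    if unlift ord_max i is Some j then tnth hw.1 j else hw.2); last first.
  by apply/funext => hw /=; rewrite tnth_mktuple.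
case: (unlift ord_max i) => [j|]; last exact: measurable_snd.
exact: (measurableT_comp (measurable_tnth j) measurable_fst).
Qed.

Lemma measurable_tuple_unsnoc : measurable_fun [set: t.+1.-tuple W]
  tuple_unsnoc.
Proof.
apply: measurable_fun_pair; last exact: measurable_tnth.
apply/measurable_fun_tnthP => i.
rewrite (_ : _ \o _ = fun h : t.+1.-tuple W => tnth h (lift ord_max i)).
  exact: measurable_tnth.
by apply/funext => h /=; rewrite tnth_mktuple.
Qed.

End tuple_snoc.

Section history.
Context d (Omega : measurableType d) dW (W : measurableType dW) (X : nat ->
  Omega -> W).

Lemma history_snoc t w : history X t.+1 w = tuple_snoc (history X t w, X t w).
Proof.
apply: eq_from_tnth => i; rewrite !tnth_mktuple /=.
case: unliftP => [j ->|->//]; rewrite tnth_mktuple.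
by congr (X _ w); rewrite lift_max.
Qed.

Lemma history_unsnoc t w : tuple_unsnoc (history X t.+1 w) = (history X t w, X t
  w).
Proof.
rewrite /tuple_unsnoc; congr pair; last by rewrite tnth_mktuple.
apply: eq_from_tnth => i; rewrite !tnth_mktuple.
by congr (X _ w); rewrite lift_max.
Qed.

(** Serves to make all states up to time [t] functions of H_t. *)
Lemma history_widen s t : (s <= t)%N ->
  exists2 f : t.-tuple W -> s.-tuple W, measurable_fun [set: t.-tuple W] f &
    history X s = f \o history X t.
Proof.
move=> st; exists (fun h => [tuple tnth h (widen_ord st i) | i < s]).
  apply/measurable_fun_tnthP => i.
  rewrite (_ : _ \o _ = fun h : t.-tuple W => tnth h (widen_ord st i)).
    exact: measurable_tnth.
  by apply/funext => h /=; rewrite tnth_mktuple.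
apply/funext => w; apply: eq_from_tnth => i.
by rewrite !tnth_mktuple.
Qed.

Hypothesis mX : forall n, measurable_fun [set: Omega] (X n).

Lemma measurable_history t : measurable_fun [set: Omega] (history X t).
Proof.
apply/measurable_fun_tnthP => i; rewrite (_ : _ \o _ = X i)//.
by apply/funext => w /=; rewrite tnth_mktuple.
Qed.

Lemma measurable_future t : measurable_fun [set: Omega] (future X t).
Proof. by apply: measurable_fun_paths => n; exact: mX. Qed.

End history.

(** * The transition kernel *)

Section update_law.
Context (R : realType) dW (W : measurableType dW).
Variable Phi : law (paths W) R * W -> law (paths W) R.
Hypothesis mPhi : measurable_fun [set: law (paths W) R * W] Phi.

(** Taking a whole path lets the kernel be an image of [s] itself; [update_pkerE] returns to the
    first marginal. *)
Definition update_map (sy : law (paths W) R * paths W) : law (paths W) R :=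
  Phi (sy.1, path_head sy.2).

Lemma measurable_update_map :
  measurable_fun [set: law (paths W) R * paths W] update_map.
Proof.
apply: (measurableT_comp mPhi); apply: measurable_fun_pair => //.
exact: (measurableT_comp (@measurable_path_head _ W) measurable_snd).
Qed.

Lemma measurable_update_map_r s :
  measurable_fun [set: paths W] (fun y => update_map (s, y)).
Proof.
apply: (measurableT_comp (g := fun y => (s, y)) measurable_update_map).
exact: measurable_fun_pair.
Qed.

Definition update_prob (s : law (paths W) R) :
    {measure set (law (paths W) R) -> \bar R} :=
  law_map (measurable_update_map_r s) s.

Lemma update_probE s B : measurable B ->
  update_prob s B = \int[s]_y (\1_B (update_map (s, y)))%:E.
Proof.
move=> mB; have mC := measurable_fun_preimage (measurable_update_map_r s) mB.
transitivity (s ((fun y => update_map (s, y)) @^-1` B)); first exact: law_mapE.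
by have := integral_indic s measurableT mC; rewrite setIT => <-.
Qed.

Let measurable_update_prob B : measurable B ->
  measurable_fun [set: law (paths W) R] (update_prob ^~ B).
Proof.
move=> mB; under eq_fun do rewrite update_probE//.
apply: (@measurable_law_integral _ _ _ (paths W) R id (@measurable_id _ _ _)
  (fun z => (\1_B (update_map z))%:E)); last by move=> z; rewrite lee_fin.
apply/measurable_EFinP; apply: (measurableT_comp (measurable_indic mB)).
exact: measurable_update_map.
Qed.

HB.instance Definition _ := isKernel.Build _ _ _ _ R update_prob
  measurable_update_prob.

Let update_prob_setT s : update_prob s [set: law (paths W) R] = 1.
Proof. exact: probability_setT. Qed.

HB.instance Definition _ := Kernel_isProbability.Build _ _ _ _ R update_prob
  update_prob_setT.

Definition update_pker : R.-pker law (paths W) R ~> law (paths W) R :=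
  update_prob.

Lemma update_pkerE s B : measurable B -> update_pker s B = update_kernel Phi s
  B.
Proof.
move=> mB; rewrite [LHS]update_probE// /update_kernel /first_marginal.
rewrite (ge0_integral_pushforward (@measurable_path_head _ W))//=.
apply/measurable_EFinP; apply: (measurableT_comp (measurable_indic mB)).
by apply: (measurableT_comp mPhi); exact: measurable_fun_pair.
Qed.

End update_law.
Lemma path_head_future d (Omega : measurableType d) dW (W : measurableType dW)
    (X : nat -> Omega -> W) t w : path_head (future X t w) = X t w.
Proof. by congr (X _ w); rewrite addn0. Qed.

Lemma path_tail_future d (Omega : measurableType d) dW (W : measurableType dW)
    (X : nat -> Omega -> W) t w : path_tail (future X t w) = future X t.+1 w.
Proof. by apply/funext => n; congr (X _ w); rewrite addnS. Qed.

(** * The process of predictive states *)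

Section predictive_process.
Context (R : realType) d (Omega : measurableType d) (P : probability Omega R).
Context dW (W : measurableType dW) (X : nat -> Omega -> W).
Variables (kappa : forall t : nat, t.-tuple W -> law (paths W) R)
  (Phi : law (paths W) R * W -> law (paths W) R).
Hypotheses (hW : standard_borel R W)
  (mX : forall n, measurable_fun [set: Omega] (X n))
  (kappaP : forall t, regular_cond_law P (future X t) (history X t) (@kappa t))
  (PhiP : tail_disintegration Phi).

Let Sigma t w := kappa (history X t w).

Arguments kappaP : clear implicits.
Let mH t : measurable_fun [set: Omega] (history X t).
Proof. exact: measurable_history. Qed.
Let mF t : measurable_fun [set: Omega] (future X t).
Proof. exact: measurable_future. Qed.
Let mkappa t : measurable_fun [set: t.-tuple W] (@kappa t).
Proof. by case: (kappaP t). Qed.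
Arguments mH : clear implicits.
Arguments mF : clear implicits.
Let mPhi := PhiP.1.

Lemma measurable_predictive t : measurable_fun [set: Omega] (Sigma t).
Proof. exact: (measurableT_comp (@mkappa t) (mH t)). Qed.
Arguments measurable_predictive : clear implicits.

Let Phi_eval B (z : law (paths W) R * W) : \bar R := Phi z B.

Let mPhi_eval B : measurable B ->
  measurable_fun [set: law (paths W) R * W] (Phi_eval B).
Proof.
move=> mB; have := measurableT_comp (@measurable_law_eval _ _ R B mB) mPhi.
exact.
Qed.

Let mkappa_fst t d' (T : measurableType d') (f : T -> t.-tuple W) (g : T -> W) :
  measurable_fun [set: T] f -> measurable_fun [set: T] g ->
  measurable_fun [set: T] (fun x => (kappa (f x), g x)).
Proof.
move=> mf mg; apply: measurable_fun_pair => //.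
exact: (measurableT_comp (@mkappa t) mf).
Qed.

(** [phi] and [psi] express the two sides through H_t and the future from [t], so [kappaP t]
    integrates the future out and leaves an identity for the law [kappa h]. *)
Lemma cond_prob_update t B : measurable B ->
  cond_prob P (g_sigma_algebra_preimage (history X t.+1))
    (future X t.+1 @^-1` B) (fun w => Phi (Sigma t w, X t w) B).
Proof.
move=> mB; split.
- move=> D mD.
  exists ((fun h => Phi_eval B (kappa (tuple_unsnoc h).1, (tuple_unsnoc h).2))
    @^-1` D).
    apply: measurable_fun_preimage => //.
    apply: (measurableT_comp (mPhi_eval mB)).
    apply: mkappa_fst.
      exact: (measurableT_comp measurable_fst (@measurable_tuple_unsnoc _ W t)).
    exact: (measurableT_comp measurable_snd (@measurable_tuple_unsnoc _ W t)).
  rewrite setTI -comp_preimage; congr (_ @^-1` D); apply/funext => w.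
  by rewrite /comp history_unsnoc.
- apply: integrable_le1.
    by apply: (measurableT_comp (mPhi_eval mB)); exact: mkappa_fst.
  by move=> w; rewrite measure_ge0 probability_le1.
- move=> _ [A mA <-]; rewrite setTI.
  have mHA := measurable_fun_preimage (mH t.+1) mA.
  have mFB := measurable_fun_preimage (mF t.+1) mB.
  pose c (z : t.-tuple W * paths W) := tuple_snoc (z.1, path_head z.2).
  have mhd : measurable_fun [set: t.-tuple W * paths W] (fun z => path_head
    z.2).
    exact: (measurableT_comp (@measurable_path_head _ W) measurable_snd).
  have mc : measurable_fun [set: t.-tuple W * paths W] c.
    apply: (measurableT_comp (@measurable_tuple_snoc _ W t)).
    exact: measurable_fun_pair.
  have mcA := measurable_fun_preimage mc mA.
  pose phi (z : t.-tuple W * paths W) : \bar R :=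
    (\1_(c @^-1` A) z)%:E * Phi_eval B (kappa z.1, path_head z.2).
  pose psi (z : t.-tuple W * paths W) : \bar R :=
    (\1_(c @^-1` A `&` (@path_tail _ W \o snd) @^-1` B) z)%:E.
  have mtlB : measurable ((@path_tail _ W \o snd) @^-1` B : set (t.-tuple W *
    paths W)).
    apply: measurable_fun_preimage => //.
    exact: (measurableT_comp (@measurable_path_tail _ W) measurable_snd).
  have mphi : measurable_fun [set: t.-tuple W * paths W] phi.
    apply: emeasurable_funM; first exact/measurable_EFinP/measurable_indic.
    by apply: (measurableT_comp (mPhi_eval mB)); exact: mkappa_fst.
  have mpsi : measurable_fun [set: t.-tuple W * paths W] psi.
    by apply/measurable_EFinP/measurable_indic; exact: measurableI.
  have cE w : c (history X t w, future X t w) = history X t.+1 w.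
    by rewrite history_snoc -(path_head_future X t w).
  (* Conditionally on H_t = h, the claim is the defining property of Phi (s, -)
     for s = kappa h. *)
  transitivity (\int[P]_w phi (history X t w, future X t w)).
    rewrite -integral_indic_mul; apply: eq_integral => w _.
    rewrite /phi /Phi_eval [in RHS]path_head_future; congr (_%:E * _).
    by rewrite !indicE; congr ((_ : bool)%:R); apply/idP/idP; rewrite !inE /=
      cE.
  rewrite (regular_cond_law_integral (mF t) (mH t) (kappaP t))//; last first.
    by move=> z; rewrite mule_ge0// lee_fin.
  transitivity (\int[P]_w psi (history X t w, future X t w)); last first.
    rewrite [LHS](_ : _ = \int[P]_w (\1_(history X t.+1 @^-1` A `&` future X
      t.+1 @^-1` B) w)%:E).
      by rewrite integral_indic ?setIT//; exact: measurableI.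
    apply: eq_integral => w _; rewrite /psi !indicE; congr ((_ : bool)%:R%:E).
    by apply/idP/idP; rewrite !inE /= cE path_tail_future.
  rewrite [RHS](regular_cond_law_integral (mF t) (mH t) (kappaP t))//; last
    first.
    by move=> z; rewrite lee_fin.
  apply: eq_integral => w _; set h := history X t w; set s := kappa h.
  (* For fixed [h], the condition that H_{t+1} lies in [A] bears on the first future coordinate
     alone, so it is an event to which the disintegration by [Phi] applies. *)
  have mAh : measurable [set x | A (tuple_snoc (h, x))].
    apply: measurable_fun_preimage => //.
    apply: (measurableT_comp (@measurable_tuple_snoc _ W t)).
    exact: measurable_fun_pair.
  have mAhh := measurable_fun_preimage (@measurable_path_head _ W) mAh.
  have mtB := measurable_fun_preimage (@measurable_path_tail _ W) mB.
  have [_ _ /(_ (@path_head _ W @^-1` [set x | A (tuple_snoc (h, x))]))] :=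
    (PhiP.2 s).2 B mB.
  rewrite -integral_indic_mul => E.
  transitivity (s (@path_head _ W @^-1` [set x | A (tuple_snoc (h, x))] `&`
    @path_tail _ W @^-1` B)).
    rewrite -E; last by exists [set x | A (tuple_snoc (h, x))] => //; rewrite
      setTI.
    by apply: eq_integral => y _.
  have := integral_indic s measurableT (measurableI _ _ mAhh mtB); rewrite setIT
    => <-.
  by apply: eq_integral => y _.
Qed.

(** For each determining event [B n] the two sides are versions of one conditional probability given
    H_{t+1}; the countably many exceptional null sets are discarded together. *)
Lemma predictive_update t :
  {ae P, forall w, Sigma t.+1 w = Phi (Sigma t w, X t w)}.
Proof.
have [B mB BP] := law_paths_determined hW.
have : {ae P, forall w, forall n, Sigma t.+1 w (B n) = Phi (Sigma t w, X t w) (B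
  n)}.
  apply: ae_foralln => n.
  have := cond_prob_unique (mH t.+1) ((kappaP t.+1).2 _ (mB n))
    (cond_prob_update t (mB n)).
  by apply: filterS => w /(_ Logic.I).
by apply: filterS => w; exact: BP.
Qed.

(** By the recursive update, the next state is almost surely the function [U] of H_t and the future;
    integrating the future out under [kappa h] turns the indicator of [U] in [B] into the kernel. *)
Lemma cond_prob_transition t B : measurable B ->
  cond_prob P (g_sigma_algebra_preimage (history X t)) (Sigma t.+1 @^-1` B)
    (fun w => update_pker mPhi (Sigma t w) B).
Proof.
move=> mB; have mK := measurable_kernel (update_pker mPhi) B mB.
have mKk : measurable_fun [set: t.-tuple W] (fun h => update_pker mPhi (kappa h)
  B).
  exact: (measurableT_comp mK (@mkappa t)).
split.
- move=> D mD; exists ((fun h => update_pker mPhi (kappa h) B) @^-1` D); last by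
    rewrite setTI.
  exact: measurable_fun_preimage.
- apply: integrable_le1; first exact: (measurableT_comp mKk (mH t)).
  by move=> w; rewrite measure_ge0 probability_le1.
- move=> _ [A mA <-]; rewrite setTI.
  have mHA := measurable_fun_preimage (mH t) mA.
  have mSB := measurable_fun_preimage (measurable_predictive t.+1) mB.
  pose U (z : t.-tuple W * paths W) := update_map Phi (kappa z.1, z.2).
  have mU : measurable_fun [set: t.-tuple W * paths W] U.
    apply: (measurableT_comp (measurable_update_map mPhi)).
    apply: measurable_fun_pair => //.
    exact: (measurableT_comp (@mkappa t) measurable_fst).
  have mUB := measurable_fun_preimage mU mB.
  pose phi (z : t.-tuple W * paths W) : \bar R := (\1_A z.1)%:E * (\1_(U @^-1`
    B) z)%:E.
  have mphi : measurable_fun [set: t.-tuple W * paths W] phi.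
    apply: emeasurable_funM; last exact/measurable_EFinP/measurable_indic.
    by apply/measurable_EFinP; exact: (measurableT_comp (measurable_indic mA)
      measurable_fst).
  transitivity (\int[P]_w phi (history X t w, future X t w)).
    rewrite (regular_cond_law_integral (mF t) (mH t) (kappaP t))//; last first.
      by move=> z; rewrite mule_ge0// lee_fin.
    rewrite -integral_indic_mul; apply: eq_integral => w _; set h := history X t
      w.
    have mUh : measurable_fun [set: paths W] (fun y => (\1_(U @^-1` B) (h,
      y))%:E : \bar R).
      apply/measurable_EFinP.
      apply: (measurableT_comp (g := fun y => (h, y)) (measurable_indic mUB)).
      exact: measurable_fun_pair.
    transitivity ((\1_A h)%:E * \int[kappa h]_y (\1_(U @^-1` B) (h, y))%:E).
      by congr (_ * _); exact: update_probE.
    by rewrite -ge0_integralZl.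
  transitivity (\int[P]_w (\1_(history X t @^-1` A `&` Sigma t.+1 @^-1` B)
    w)%:E); last first.
    by rewrite integral_indic ?setIT//; exact: measurableI.
  apply: ae_eq_integral => //.
  - exact: (measurableT_comp mphi (measurable_fun_pair (mH t) (mF t))).
  - by apply/measurable_EFinP/measurable_indic; exact: measurableI.
  - apply: filterS (predictive_update t) => w SE _.
    rewrite /phi -EFinM !indicE -natrM mulnb; congr ((_ : bool)%:R%:E).
    have UE : U (history X t w, future X t w) = Sigma t.+1 w.
      by rewrite SE -[in RHS](path_head_future X t w).
    by apply/andP/idP; rewrite !inE /= UE.
Qed.

(** The transition probability given H_t is a function of the current state, and the natural
    filtration lies between the sigma-algebras of that state and of H_t. *)
Lemma predictive_markov : markov_process P Sigma (update_pker mPhi).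
Proof.
split; first exact: measurable_predictive.
move=> t B mB; apply: cond_prob_coarser (cond_prob_transition t mB).
- apply: smallest_sub.
    exact: (@sigma_algebra_measurable _ (g_sigma_algebra_preimageType (history X
      t))).
  move=> A [s /= st].
  have [f mf Hst] := history_widen X st.
  rewrite /Sigma Hst => hA.
  apply: (g_sigma_algebra_preimage_comp mf).
  by apply: (g_sigma_algebra_preimage_comp (@mkappa s)).
- move=> D mD; apply: sub_sigma_algebra; exists t => //=.
  have mK := measurable_kernel (update_pker mPhi) B mB.
  exists ((fun s => update_pker mPhi s B) @^-1` D); last by rewrite setTI.
  exact: measurable_fun_preimage.
Qed.

End predictive_process.
Theorem theorem5 (R : realType)
  (d : measure_display) (Omega : measurableType d) (P : probability Omega R)
  (dW : measure_display) (W : measurableType dW) (hW : standard_borel R W)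
  (X : nat -> Omega -> W) (hX : forall n, measurable_fun [set: Omega] (X n))
  (kappa : forall t : nat, t.-tuple W -> law (paths W) R)
  (hkappa : forall t : nat,
     regular_cond_law P (future X t) (history X t) (@kappa t))
  (Phi : law (paths W) R * W -> law (paths W) R)
  (hPhi : tail_disintegration Phi) :
  let Sigma (t : nat) (w : Omega) : law (paths W) R :=
    kappa t (history X t w) in
  (* full-future sufficiency and minimality *)
  (forall t : nat,
     cond_indep P (future X t) (history X t) (Sigma t) /\
     forall (dT : measure_display) (T : measurableType dT)
            (rho : t.-tuple W -> T),
       history_statistic R rho ->
       cond_indep P (future X t) (history X t) (rho \o history X t) ->
       (exists2 g : T -> law (paths W) R,
          measurable_fun [set: T] g &
          {ae P, forall w, Sigma t w = g (rho (history X t w))}) /\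
       sub_mod_null P (g_sigma_algebra_preimage (Sigma t))
         (g_sigma_algebra_preimage (rho \o history X t))) /\
  (* recursive update *)
  (forall t : nat, {ae P, forall w, Sigma t.+1 w = Phi (Sigma t w, X t w)}) /\
  (* Markov representation *)
  (exists2 K : R.-pker law (paths W) R ~> law (paths W) R,
     (forall s B, measurable B -> K s B = update_kernel Phi s B) &
     markov_process P Sigma K) /\
  (* recursive predictive representation, factor of every sufficient one *)
  recursive_predictive_representation P X kappa /\
  (forall (dT : nat -> measure_display) (T : forall t, measurableType (dT t))
          (rho : forall t : nat, t.-tuple W -> T t),
     (forall t, full_future_sufficient P X (rho t)) ->
     forall t, exists2 g : T t -> law (paths W) R,
       measurable_fun [set: T t] g &
       {ae P, forall w, Sigma t w = g (rho t (history X t w))}) /\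
  (forall (dT : nat -> measure_display) (T : forall t, measurableType (dT t))
          (rho : forall t : nat, t.-tuple W -> T t),
     recursive_predictive_representation P X rho ->
     forall t, exists2 g : T t -> law (paths W) R,
       measurable_fun [set: T t] g &
       {ae P, forall w, Sigma t w = g (rho t (history X t w))}).
Proof.
move=> Sigma.
have mH t := @measurable_history _ _ _ _ X hX t.
have mF t := @measurable_future _ _ _ _ X hX t.
have mkappa t : measurable_fun [set: t.-tuple W] (@kappa t) by case: (hkappa t).
have sufficient t : cond_indep P (future X t) (history X t) (Sigma t).
  have := predictive_sufficient (mH t) (hkappa t); exact.
have minimal t d1 (T : measurableType d1) (rho : t.-tuple W -> T) :
    history_statistic R rho ->
    cond_indep P (future X t) (history X t) (rho \o history X t) ->
    exists2 g : T -> law (paths W) R, measurable_fun [set: T] g &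
      {ae P, forall w, Sigma t w = g (rho (history X t w))}.
  move=> [_ mrho].
  have := @predictive_minimal _ _ _ _ _ _ _ _ _ _ _ _ _ rho hW (mF t) (mH t)
    (hkappa t) mrho; exact.
have update := predictive_update hW hX hkappa hPhi.
split; [|split; [|split; [|split; [|split]]]].
- move=> t; split=> [//|dT T rho rhoP rho_suff].
  have [g mg Sg] := minimal t dT T rho rhoP rho_suff.
  split; first by exists g.
  apply: (ae_eq_sub_mod_null _ _ mg Sg).
  + exact: (measurableT_comp (mkappa t) (mH t)).
  + exact: (measurableT_comp rhoP.2 (mH t)).
- exact: update.
- exists (update_pker hPhi.1); first by move=> s B mB; exact: update_pkerE.
  exact: predictive_markov.
(* The statistic is [kappa t] itself, and one closure map, [Phi], serves at every time. *)
- split=> [t|t]; last by exists Phi; split; [exact: hPhi.1|exact: update].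
  by split; [split; [exact: standard_borel_law_paths|exact: mkappa]|exact:
    sufficient].
- by move=> dT T rho rhoP t; have [rho_stat rho_suff] := rhoP t; exact: minimal.
- by move=> dT T rho [rhoP _] t; have [rho_stat rho_suff] := rhoP t; exact:
    minimal.
Qed.
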